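(* Consider sample-based TD-PMD run for $T\ge1$ iterations with $\|V^0\|_\infty\le 1/(1-\gamma)$. For each $k$ let $\widehat\pi_k$ be any policy with $\langle\widehat\pi_k(\cdot|s),\widehat Q^k(s,\cdot)\rangle=\max_a\widehat Q^k(s,a)$ for all $s$, let $c>0$ be an arbitrary constant, and assume the step sizes satisfy $\eta_k\ge\|D^{\widehat\pi_k}_{\pi_k}\|_\infty/(c\,\gamma^{2k+1})$ for all $k$. Let $\delta>0$ and $\alpha\in(0,1)$. If $$M_Q\ge\frac{1}{2(1-\gamma)^2\delta^2}\log\frac{4T|\mathcal{S}||\mathcal{A}|}{\alpha},\qquad M_V\ge\frac{1}{2(1-\gamma)^2\delta^2}\log\frac{4T|\mathcal{S}|}{\alpha},$$ then with probability at least $1-\alpha$, $$\|V^*-V^{\pi_T}\|_\infty\le\frac{1}{(1-\gamma)^2}\left[2(2+c)\gamma^{T-1}+7\delta\right].$$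
   Context: MDP: $\mathcal{S},\mathcal{A}$ are finite nonempty sets (states, actions), $P(\cdot|s,a)$ is a transition kernel, $r:\mathcal{S}\times\mathcal{A}\to[0,1]$ is the reward, $\gamma\in(0,1)$. $\Delta(X)$ is the probability simplex on $X$. A policy $\pi$ assigns $\pi(\cdot|s)\in\Delta(\mathcal{A})$ to each $s$. $V^\pi(s)=\mathbb{E}[\sum_{t\ge0}\gamma^t r(s_t,a_t)\mid s_0=s,\pi]$ with $a_t\sim\pi(\cdot|s_t)$, $s_{t+1}\sim P(\cdot|s_t,a_t)$; $V^*(s)=\max_\pi V^\pi(s)$. $\|\cdot\|_\infty$ is the max norm. Mirror map: $h$ is a convex function of Legendre type on $\mathbb{R}^{|\mathcal{A}|}$ with $\Delta(\mathcal{A})\subseteq\mathrm{dom}\,h$ and $\mathrm{rint}\,\mathrm{dom}\,h\cap\Delta(\mathcal{A})\ne\varnothing$. $D_h(p,p')=h(p)-h(p')-\langle\nabla h(p'),p-p'\rangle$. For policies $\pi,\pi'$ put $D^{\pi}_{\pi'}(s)=D_h(\pi(\cdot|s),\pi'(\cdot|s))$ and $\|D^\pi_{\pi'}\|_\infty=\max_s D^\pi_{\pi'}(s)$; for $p\in\Delta(\mathcal{A})$, $D^p_{\pi'}(s)=D_h(p,\pi'(\cdot|s))$. Initial policies satisfy $\pi_0(\cdot|s)\in\mathrm{rint}\,\mathrm{dom}\,h$ for all $s$. Sample-based TD-PMD with step sizes $\eta_k>0$ and sample numbers $M_Q,M_V$ (positive integers): given $V^0\in\mathbb{R}^{|\mathcal{S}|}$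 and $\pi_0$, for $k=0,\dots,T-1$: (i) for each $(s,a)$ draw fresh i.i.d. samples $s'_{(1)},\dots,s'_{(M_Q)}\sim P(\cdot|s,a)$ and set $\widehat Q^k(s,a)=\frac1{M_Q}\sum_{i=1}^{M_Q}[r(s,a)+\gamma V^k(s'_{(i)})]$; (ii) for every $s$ set $\pi_{k+1}(\cdot|s)=\arg\max_{p\in\Delta(\mathcal{A})}\{\eta_k\langle p,\widehat Q^k(s,\cdot)\rangle-D^p_{\pi_k}(s)\}$; (iii) for each $s$ draw fresh i.i.d. pairs $(a_{(i)},s'_{(i)})$, $i=1,\dots,M_V$, with $a_{(i)}\sim\pi_{k+1}(\cdot|s)$, $s'_{(i)}\sim P(\cdot|s,a_{(i)})$, and set $V^{k+1}(s)=\frac1{M_V}\sum_{i=1}^{M_V}[r(s,a_{(i)})+\gamma V^k(s'_{(i)})]$. Samples at each step are independent of the past given the current iterates. *)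

(* Defs.v *)
From HB Require Import structures.
From mathcomp Require Import all_boot all_order all_algebra.
From mathcomp Require Import all_classical all_reals all_analysis.
Set Implicit Arguments.
Unset Strict Implicit.
Unset Printing Implicit Defensive.
Import Order.TTheory GRing.Theory Num.Theory.
Import numFieldNormedType.Exports.
Local Open Scope classical_set_scope.
Local Open Scope ring_scope.

(* A vector of R^|A| is a
   row vector of size #|A|; its coordinate at the action a is the one of index
   enum_rank a. *)

Section Vectors.
Context {R : realType}.

Definition dotv {n} (u v : 'rV[R]_n) : R := \sum_(i < n) u 0 i * v 0 i.

Definition simplex (n : nat) : set 'rV[R]_n :=
  [set p | (forall i, 0 <= p 0 i) /\ \sum_(i < n) p 0 i = 1].

Definition norm_infty {I : finType} (f : I -> R) : R :=
  \big[Num.max/0]_(i : I) `|f i|.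

(* The point i0 only witnesses that I is nonempty: the value does not depend
   on it. *)
Definition fmax {I : finType} (i0 : I) (f : I -> R) : R :=
  \big[Num.max/f i0]_(i : I) f i.

End Vectors.

Section ConvexAnalysis.
Context {R : realType} {n : nat}.
Notation vec := 'rV[R]_n.

Definition edom (h : vec -> \bar R) : set vec := [set x | (h x < +oo)%E].

Definition proper_efun (h : vec -> \bar R) : Prop :=
  (forall x, h x != -oo%E) /\ edom h !=set0.

(* For proper h no -oo + +oo occurs on the right-hand side. *)
Definition convex_efun (h : vec -> \bar R) : Prop :=
  forall (x y : vec) (t : R), 0 < t -> t < 1 ->
    (h (t *: x + (1 - t) *: y)%R <= t%:E * h x + (1 - t)%R%:E * h y)%E.

Definition strictly_convex_on (C : set vec) (h : vec -> \bar R) : Prop :=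
  forall (x y : vec) (t : R), C x -> C y -> x != y -> 0 < t -> t < 1 ->
    (h (t *: x + (1 - t) *: y)%R < t%:E * h x + (1 - t)%R%:E * h y)%E.

Definition affine_set (M : set vec) : Prop :=
  forall (x y : vec) (t : R), M x -> M y -> M (t *: x + (1 - t) *: y).

Definition affine_hull (C : set vec) : set vec :=
  \bigcap_(M in [set M : set vec | affine_set M /\ C `<=` M]) M.

Definition rint (C : set vec) : set vec :=
  [set x | C x /\
    exists2 e : R, 0 < e & ball x e `&` affine_hull C `<=` C].

Definition fin_part (h : vec -> \bar R) : vec -> R := fun x => fine (h x).

Definition grad (h : vec -> \bar R) (x : vec) : vec :=
  \row_(i < n) 'D_(delta_mx 0 i) (fin_part h) x.

(* Rockafellar, Convex Analysis, Section 26. *)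
Definition essentially_smooth (h : vec -> \bar R) : Prop :=
  let C := interior (edom h) in
  [/\ C !=set0,
      forall x, C x -> differentiable (fin_part h) x &
      forall (u : nat -> vec) (x : vec), (forall k, C (u k)) ->
        (closure C `\` C) x -> u @ \oo --> x ->
        `|grad h (u k)| @[k --> \oo] --> +oo].

Definition legendre (h : vec -> \bar R) : Prop :=
  [/\ proper_efun h, convex_efun h, essentially_smooth h &
      strictly_convex_on (interior (edom h)) h].

Definition bregman (h : vec -> \bar R) (p p' : vec) : R :=
  fin_part h p - fin_part h p' - dotv (grad h p') (p - p').

End ConvexAnalysis.

Record mdp (R : realType) (S A : finType) := MDP {
  trans : S -> A -> S -> R;
  reward : S -> A -> R;
  discount : R;
  trans_ge0 : forall s a s', 0 <= trans s a s';
  trans_sum1 : forall s a, \sum_(s' : S) trans s a s' = 1;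
  reward_ge0 : forall s a, 0 <= reward s a;
  reward_le1 : forall s a, reward s a <= 1;
  discount_gt0 : 0 < discount;
  discount_lt1 : discount < 1
}.

Section MDP.
Context {R : realType} {S A : finType}.
Implicit Types (M : mdp R S A).

(* Also used for action-value functions: row s lists the values at (s, a). *)
Definition table := S -> 'rV[R]_#|A|.

Definition entry (f : table) (s : S) (a : A) : R := f s 0 (enum_rank a).

Definition is_policy (pi : table) : Prop := forall s, simplex (pi s).

(* A measurable space of infinite trajectories (s_0, a_0, s_1, a_1, ...) with,
   for every policy pi and initial state s, the probability under which s_0 = s,
   a_t ~ pi(.|s_t) and s_{t+1} ~ P(.|s_t, a_t); the law of the trajectory is
   fixed by its finite-dimensional marginals. *)
Record trajectory_model M := TrajectoryModel {
  traj_display : measure_display;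
  traj_space : measurableType traj_display;
  traj_state : nat -> traj_space -> S;
  traj_action : nat -> traj_space -> A;
  traj_prob : table -> S -> probability traj_space R;
  traj_state_measurable : forall t s, measurable (traj_state t @^-1` [set s]);
  traj_action_measurable : forall t a, measurable (traj_action t @^-1` [set a]);
  traj_law : forall (pi : table) (s : S), is_policy pi ->
    forall (n : nat) (x : nat -> S) (y : nat -> A),
    traj_prob pi s [set w | forall t, (t <= n)%N ->
        traj_state t w = x t /\ traj_action t w = y t] =
    ((x 0%N == s)%:R * entry pi (x 0%N) (y 0%N) *
     \prod_(t < n) (trans M (x t) (y t) (x t.+1) *
                    entry pi (x t.+1) (y t.+1)))%:E
}.

Definition discounted_return M (E : trajectory_model M) (w : traj_space E) : R :=
  limn (series (fun t : nat =>
    discount M ^+ t * reward M (traj_state t w) (traj_action t w))).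

Definition value M (E : trajectory_model M) (pi : table) (s : S) : R :=
  fine ('E_(traj_prob E pi s)[@discounted_return M E])%E.

(* The supremum is a maximum, since a finite discounted MDP has an optimal
   policy. *)
Definition opt_value M (E : trajectory_model M) (s : S) : R :=
  sup [set value E pi s | pi in [set pi | is_policy pi]].

(* D^p_{pi'}(s) at p = pi(.|s). *)
Definition policy_div (h : 'rV[R]_#|A| -> \bar R) (pi pi' : table) (s : S) : R :=
  bregman h (pi s) (pi' s).

Definition is_pmd_update (h : 'rV[R]_#|A| -> \bar R) (eta : R)
    (q p' p : 'rV[R]_#|A|) : Prop :=
  let obj z := eta * dotv z q - bregman h z p' in
  simplex p /\ (forall z, simplex z -> obj z <= obj p).

End MDP.

Section SampledTDPMD.
Context {R : realType} {S A : finType} (M : mdp R S A).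
Context (h : 'rV[R]_#|A| -> \bar R) (T MQ MV : nat).
Context {d : measure_display} {Om : measurableType d} (Pr : probability Om R).
(* The samples drawn at iteration k in steps (i) and (iii), and the iterates,
   as functions of the outcome. *)
Context (XQ : nat -> S -> A -> 'I_MQ -> Om -> S)
        (XV : nat -> S -> 'I_MV -> Om -> A * S).
Context (V : nat -> Om -> S -> R) (pi : nat -> Om -> @table R S A)
        (eta : nat -> Om -> R).

Definition Qhat (k : nat) (w : Om) : @table R S A := fun s =>
  \row_(j < #|A|) let a := enum_val j in
    MQ%:R^-1 * \sum_(i < MQ) (reward M s a + discount M * V k w (XQ k s a i w)).

Definition TD_update (k : nat) (w : Om) (s : S) : R :=
  MV%:R^-1 * \sum_(i < MV) (reward M s (XV k s i w).1
                            + discount M * V k w (XV k s i w).2).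

(* past k w is the event that all the samples of the iterations before k take
   the values observed at w; pastQ k w adds the samples of step (i) at k. *)
Definition past (k : nat) (w : Om) : set Om :=
  [set w' | forall j, (j < k)%N ->
    (forall s a i, XQ j s a i w' = XQ j s a i w) /\
    (forall s i, XV j s i w' = XV j s i w)].

Definition pastQ (k : nat) (w : Om) : set Om :=
  past k w `&` [set w' | forall s a i, XQ k s a i w' = XQ k s a i w].

(* V0 and pi0 are deterministic, so V k is a function of the samples of the
   iterations before k, and pi k.+1 of these and of the samples of step (i) at
   k, provided the step sizes are (run_eta; deterministic step sizes are a
   special case).  The samples being finitely valued, run_lawQ and run_lawV say
   that the conditional law of the fresh samples given the past is the
   prescribed product law. *)
Record td_pmd_run (V0 : S -> R) (pi0 : @table R S A) : Prop := TdPmdRun {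
  run_V0 : forall w s, V 0%N w s = V0 s;
  run_pi0 : forall w s, pi 0%N w s = pi0 s;
  run_pi : forall k w s, (k < T)%N ->
    is_pmd_update h (eta k w) (Qhat k w s) (pi k w s) (pi k.+1 w s);
  run_V : forall k w s, (k < T)%N -> V k.+1 w s = TD_update k w s;
  run_eta_gt0 : forall k w, (k < T)%N -> 0 < eta k w;
  run_eta : forall k w w', (k < T)%N -> pastQ k w w' -> eta k w' = eta k w;
  run_XQ_measurable : forall k s a i s', (k < T)%N ->
    measurable (XQ k s a i @^-1` [set s']);
  run_XV_measurable : forall k s i z, (k < T)%N ->
    measurable (XV k s i @^-1` [set z]);
  run_lawQ : forall k w (x : S -> A -> 'I_MQ -> S), (k < T)%N ->
    Pr (past k w `&` [set w' | forall s a i, XQ k s a i w' = x s a i]) =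
    (Pr (past k w) *
     (\prod_(s : S) \prod_(a : A) \prod_(i < MQ) trans M s a (x s a i))%:E)%E;
  run_lawV : forall k w (y : S -> 'I_MV -> A * S), (k < T)%N ->
    Pr (pastQ k w `&` [set w' | forall s i, XV k s i w' = y s i]) =
    (Pr (pastQ k w) *
     (\prod_(s : S) \prod_(i < MV)
        (entry (pi k.+1 w) s (y s i).1 * trans M s (y s i).1 (y s i).2))%:E)%E
}.

End SampledTDPMD.

(* Main.v *)
Require Import Defs.
From HB Require Import structures.
From mathcomp Require Import all_boot all_order all_algebra.
From mathcomp Require Import all_classical all_reals all_analysis.
From mathcomp Require Import measurable_realfun ring lra.
Set Implicit Arguments.
Unset Strict Implicit.
Unset Printing Implicit Defensive.
Import Order.TTheory GRing.Theory Num.Theory.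
Import numFieldNormedType.Exports.
Local Open Scope classical_set_scope.
Local Open Scope ring_scope.

(* The samples at an iteration average variables whose range has length
   gamma (1 + gamma^k) / (1 - gamma) in step (i) and
   (1 + gamma^(k+1)) / (1 - gamma) in step (iii), because
   - gamma^k / (1 - gamma) <= V^k <= 1 / (1 - gamma). Conditionally on the past
   the samples are independent, so Hoeffding's inequality and a union bound
   give, with probability at least 1 - alpha, deviations of at most
   (1 - gamma) delta times these lengths at all iterations.
   On that event the optimality of the mirror step against the greedy policy,
   with the nonnegativity of the Bregman divergence, shows that pi_(k+1) is
   greedy for V^k up to c gamma^(2k+1) plus twice the deviation in step (i).
   Hence |V^k - V*| obeys a linear recursion with factor gamma, and the value
   of pi_T is compared with V* through V^(T-1). The coarser bound
   |V^k| <= 1 / (1 - gamma) would only give the constant 12 instead of 7.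
   Two facts about Legendre functions are needed. A maximizer of the mirror
   step lies in the interior of dom h, where h is differentiable, because the
   gradient blows up at the boundary; and it is unique, by strict convexity, so
   that the iterates are functions of the samples and the event is
   measurable. *)

(** * Legendre functions and the mirror step *)

Section LegendreFunctions.
Context {R : realType} {n : nat}.
Implicit Types (h : 'rV[R]_n -> \bar R) (x y z a p q : 'rV[R]_n).

Lemma fin_partE h x : proper_efun h -> edom h x -> h x = (fin_part h x)%:E.
Proof.
by move=> [hN _] hx; rewrite /fin_part fineK// fin_real// ltNye hN.
Qed.

Lemma convex_fin_part h x y (t : R) : proper_efun h -> convex_efun h ->
  edom h x -> edom h y -> 0 < t -> t < 1 ->
  edom h (t *: x + (1 - t) *: y) /\
  fin_part h (t *: x + (1 - t) *: y) <=
    t * fin_part h x + (1 - t) * fin_part h y.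
Proof.
move=> hp hc hx hy t0 t1; have := hc x y t t0 t1.
rewrite (fin_partE hp hx) (fin_partE hp hy) -!EFinM -EFinD => le.
have hd : edom h (t *: x + (1 - t) *: y).
  by rewrite /edom/= (le_lt_trans le)// ltry.
by split=> //; move: le; rewrite (fin_partE hp hd) lee_fin.
Qed.

Lemma derive_dotv_grad h x v : differentiable (fin_part h) x ->
  'D_v (fin_part h) x = dotv (grad h x) v.
Proof.
move=> df; rewrite deriveE// [in LHS](row_sum_delta v) linear_sum/=.
apply: eq_bigr => i _; rewrite linearZ/= /grad mxE deriveE//.
by rewrite [RHS]mulrC.
Qed.

Lemma dotvB (u v w : 'rV[R]_n) : dotv u (v - w) = dotv u v - dotv u w.
Proof.
by rewrite /dotv -sumrB; apply: eq_bigr => i _; rewrite !mxE mulrBr.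
Qed.

Lemma dotvC (u v : 'rV[R]_n) : dotv u v = dotv v u.
Proof. by apply: eq_bigr => i _; rewrite mulrC. Qed.

Lemma dotvD (u v w : 'rV[R]_n) : dotv u (v + w) = dotv u v + dotv u w.
Proof.
by rewrite /dotv -big_split; apply: eq_bigr => i _; rewrite !mxE mulrDr.
Qed.

Lemma dotvZ (t : R) (u v : 'rV[R]_n) : dotv u (t *: v) = t * dotv u v.
Proof.
by rewrite /dotv big_distrr; apply: eq_bigr => i _; rewrite !mxE/= mulrCA.
Qed.

Lemma dotv_delta (u : 'rV[R]_n) i : dotv u (delta_mx 0 i) = u 0 i.
Proof.
rewrite /dotv (bigD1 i)//= mxE !eqxx mulr1 big1 ?addr0// => j ji.
by rewrite mxE (negPf ji) andbF mulr0.
Qed.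

(** By convexity every difference quotient of h at x in the direction z - x is at most h z - h x.
    The directional derivative is their limit as t decreases to 0. *)
Lemma subgradient_grad h x z : proper_efun h -> convex_efun h ->
  edom h x -> edom h z -> differentiable (fin_part h) x ->
  fin_part h x + dotv (grad h x) (z - x) <= fin_part h z.
Proof.
move=> hp hc hx hz df; rewrite -lerBrDl -derive_dotv_grad//.
have /(_ (z - x))/cvg_dnbhs_at_right := @diff_derivable _ _ _ _ _ ^~ df.
move=> /cvgr_to_le; apply; near=> t.
have t0 : 0 < t by [].
have t1 : t < 1 by near: t; apply: nbhs_right_lt.
have [_] := convex_fin_part hp hc hz hx t0 t1.
rewrite /= -[t^-1 *: _]/(t^-1 * _) [t^-1 * _]mulrC ler_pdivrMr// => le.
have -> : t *: (z - x) + x = t *: z + (1 - t) *: x.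
  by rewrite scalerBr scalerBl scale1r addrAC addrA.
by move: le; lra.
Unshelve. all: by end_near.
Qed.

(** The map y -> t y + (1 - t) x sends the ball of radius e around a onto the ball of radius t e
    around the point of the segment, and convexity keeps the image in the domain. *)
Lemma edom_segment_interior h x a (t : R) : proper_efun h -> convex_efun h ->
  edom h x -> interior (edom h) a -> 0 < t -> t < 1 ->
  interior (edom h) (t *: a + (1 - t) *: x).
Proof.
move=> hp hc hx /nbhs_ballP[e /= e0 ae] t0 t1.
apply/nbhs_ballP; exists (t * e) => /=; first exact: mulr_gt0.
move=> w; rewrite -ball_normE /ball_/= => wb.
have -> : w = t *: (a + t^-1 *: (w - (t *: a + (1 - t) *: x))) + (1 - t) *: x.
  by apply/rowP => i; rewrite !mxE; field; rewrite gt_eqF.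
apply: (proj1 (convex_fin_part hp hc _ hx t0 t1)); apply: ae.
rewrite -ball_normE /ball_/= opprD addrA subrr sub0r normrN normrZ.
by rewrite gtr0_norm ?invr_gt0// mulrC ltr_pdivrMr// distrC mulrC.
Qed.

(* The gradient is bounded along the segment from a to x as soon as the slope
   of h along it is bounded below, which essential smoothness forbids when x
   is a boundary point. *)
Lemma essentially_smooth_interior h x a (L : R) :
  proper_efun h -> convex_efun h -> essentially_smooth h ->
  edom h x -> interior (edom h) a ->
  (forall t : R, 0 < t -> t < 1 ->
     t * L <= fin_part h (t *: a + (1 - t) *: x) - fin_part h x) ->
  interior (edom h) x.
Proof.
move=> hp hc [_ hdiff hblow] hx ha hL; apply: contrapT => xnC.
(* The shift by two keeps [t k] strictly below 1 already at k = 0. *)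
pose t (k : nat) : R := k.+2%:R^-1.
pose u k := t k *: a + (1 - t k) *: x.
have t0 k : 0 < t k by rewrite invr_gt0 ltr0n.
have t1 k : t k < 1 by rewrite invf_lt1 ?ltr0n// ltr1n.
have uC k : interior (edom h) (u k) by exact: edom_segment_interior.
have tcvg : t @ \oo --> (0 : R).
  by rewrite (cvg_shiftS (@harmonic R)); exact: cvg_harmonic.
have ucvg : u @ \oo --> x.
  have -> : u = (fun k => x + t k *: (a - x)).
    by apply/funext => k; apply/rowP => i; rewrite !mxE; ring.
  have : x + t k *: (a - x) @[k --> \oo] --> x + 0 *: (a - x).
    by apply: cvgD; [exact: cvg_cst|exact: cvgZr_tmp].
  by rewrite scale0r addr0.
have xcl : closure (interior (edom h)) x.
  by apply: closed_cvg ucvg; [exact: closed_closure|near=> k; exact/subset_closure].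
have /cvgryPgt gy := hblow u x uC (conj xcl xnC) ucvg.
have [e /= e0 ae] : exists2 e : R, 0 < e &
    ball a e `<=` [set z | edom h z /\ fin_part h z < fin_part h a + 1].
  have ca := differentiable_continuous (hdiff a ha).
  have : \forall z \near a, edom h z /\ fin_part h z < fin_part h a + 1.
    apply: filterI; first exact: ha.
    by apply: (cvgr_lt _ ca); rewrite ltrDl.
  by move=> /nbhs_ballP[e]; exists e.
(* The subgradient inequality at [u k], tested at a moved by e / 2 along a coordinate axis, bounds
   that coordinate of the gradient. One [|L|] pays for h at [u k], which may be below h x, the other
   for the part of the gradient along a - x. *)
pose B := (fin_part h a + 1 - fin_part h x + 2 * `|L|) / (e / 2).
have e2 : 0 < e / 2 by rewrite divr_gt0.
have gb k : `|grad h (u k)| <= `|B|.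
  (* This is the subgradient inequality at [u k] tested at x, divided by [t k]. *)
  have gx : L <= dotv (grad h (u k)) (a - x).
    have := subgradient_grad hp hc (interior_subset (uC k)) hx (hdiff _ (uC k)).
    have -> : x - u k = - t k *: (a - x).
      by apply/rowP => i; rewrite !mxE; ring.
    rewrite dotvZ => le1; have := hL _ (t0 k) (t1 k); rewrite -/(u k) => le2.
    by rewrite -(ler_pM2l (t0 k)); lra.
  have coord (s : R) i : `|s| = 1 -> s * grad h (u k) 0 i <= B.
    move=> s1; pose z := a + (s * (e / 2)) *: delta_mx 0 i.
    have [hz hza] : edom h z /\ fin_part h z < fin_part h a + 1.
      apply: ae; rewrite -ball_normE /ball_/= opprD addrA subrr sub0r normrN.
      rewrite normrZ normrM s1 mul1r gtr0_norm//.
      suff: `|delta_mx 0 i : 'rV[R]_n| <= 1 by move=> ?; nra.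
      rewrite /Num.Def.normr/= mx_normrE bigmax_le// => j _.
      by rewrite mxE; case: (_ && _); rewrite ?normr1 ?normr0.
    have := subgradient_grad hp hc (interior_subset (uC k)) hz (hdiff _ (uC k)).
    have -> : z - u k = (1 - t k) *: (a - x) + (s * (e / 2)) *: delta_mx 0 i.
      by apply/rowP => j; rewrite !mxE; ring.
    rewrite dotvD !dotvZ dotv_delta => le1.
    have := hL _ (t0 k) (t1 k); rewrite -/(u k) => le2.
    rewrite /B ler_pdivlMr//.
    have sc (r : R) : 0 < r -> r < 1 -> - `|L| <= r * L.
      by have := ler_norm (- L); rewrite normrN; have := normr_ge0 L; nra.
    have := sc _ (t0 k) (t1 k).
    have : - `|L| <= (1 - t k) * dotv (grad h (u k)) (a - x).
      apply: (@le_trans _ _ ((1 - t k) * L)).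
        by apply: sc; have := t0 k; have := t1 k; lra.
      by rewrite ler_wpM2l// subr_ge0 ltW.
    by move: le1 le2 hza; lra.
  rewrite /Num.Def.normr/= mx_normrE bigmax_le ?normr_ge0// => -[i j] _ /=.
  rewrite ord1 (le_trans _ (ler_norm _))// ler_norml lerNl.
  have := coord 1 j (normr1 _); have := coord (-1) j (normrN1 _).
  by rewrite mulN1r mul1r => -> ->.
have [k /= ] := filter_ex (gy `|B|).
by rewrite ltNge gb.
Unshelve. all: by end_near.
Qed.

(** The domain has an interior point a, and every y is an affine combination of a and a point of a
    ball around a. Hence the affine hull of the domain is the whole space. *)
Lemma rint_edom_interior h : essentially_smooth h ->
  rint (edom h) `<=` interior (edom h).
Proof.
move=> [[a ha] _ _] x [hx [e e0 xe]].
apply/nbhs_ballP; exists e => // y xy; apply: xe; split=> // N [Naff CN].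
have [r /= r0 ar] := (nbhs_ballP _ _).1 ha.
(* This t is large enough for a + (y - a) / t to lie in the ball of radius r around a. *)
pose t : R := 1 + 2 * `|y - a| / r.
have t0 : 0 < t.
  by rewrite ltr_pwDl// divr_ge0 ?mulr_ge0// ltW.
have Na : N a by apply: CN; exact: interior_subset ha.
have -> : y = t *: (a + t^-1 *: (y - a)) + (1 - t) *: a.
  by apply/rowP => i; rewrite !mxE; field; rewrite gt_eqF.
apply: Naff => //; apply/CN/ar; rewrite -ball_normE /ball_/=.
rewrite opprD addrA subrr sub0r normrN normrZ gtr0_norm ?invr_gt0//.
rewrite mulrC ltr_pdivrMr// /t mulrDr mulr1 mulrC divfK ?gt_eqF//.
by have := normr_ge0 (y - a); lra.
Qed.

Lemma bregman_ge0 h p q : legendre h -> interior (edom h) q -> edom h p ->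
  0 <= bregman h p q.
Proof.
move=> [hp hc [_ hd _] _] hq hpp.
have := subgradient_grad hp hc (interior_subset hq) hpp (hd _ hq).
by rewrite /bregman; lra.
Qed.

Lemma simplex_convex p q (t : R) : simplex p -> simplex q -> 0 <= t -> t <= 1 ->
  simplex (t *: p + (1 - t) *: q).
Proof.
move=> [p0 p1] [q0 q1] t0 t1; split=> [i|].
  by rewrite !mxE addr_ge0// mulr_ge0// subr_ge0.
under eq_bigr do rewrite !mxE.
by rewrite big_split/= -!big_distrr/= p1 q1; lra.
Qed.

End LegendreFunctions.

Section MirrorDescentStep.
Context {R : realType} {A : finType}.
Implicit Types (h : 'rV[R]_#|A| -> \bar R).

(** Optimality of p against the points of the segment from p to p' bounds the slope of h along it
    from below by L, the slope of the linear part of the objective. Then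
    [essentially_smooth_interior] applies. *)
Lemma pmd_update_interior h (eta : R) (q p' p : 'rV[R]_#|A|) :
  legendre h -> @simplex R #|A| `<=` edom h -> simplex p' ->
  interior (edom h) p' -> is_pmd_update h eta q p' p -> interior (edom h) p.
Proof.
move=> [hp hc hs _] hdom sp' ip' [sp pmax].
apply: (essentially_smooth_interior (a := p')
  (L := eta * dotv (p' - p) q + dotv (grad h p') (p' - p))) => // [|t t0 t1].
  exact: hdom.
have := pmax _ (simplex_convex sp' sp (ltW t0) (ltW t1)).
rewrite /bregman ![dotv _ q]dotvC !dotvB !dotvD !dotvZ; lra.
Qed.

(** The midpoint of two distinct maximizers would do strictly better. Strict convexity is available
    only on the interior of the domain, so the maximizers are first placed there. *)
Lemma pmd_update_unique h (eta : R) (q p' p1 p2 : 'rV[R]_#|A|) :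
  legendre h -> @simplex R #|A| `<=` edom h -> simplex p' ->
  interior (edom h) p' ->
  is_pmd_update h eta q p' p1 -> is_pmd_update h eta q p' p2 -> p1 = p2.
Proof.
move=> hl hdom sp' ip' u1 u2; apply/eqP/negPn/negP => p12.
have i1 := pmd_update_interior hl hdom sp' ip' u1.
have i2 := pmd_update_interior hl hdom sp' ip' u2.
case: hl => hp _ _ hsc; case: u1 => s1 m1; case: u2 => s2 m2.
have h0 : 0 < (2^-1 : R) by lra.
have h1 : (2^-1 : R) < 1 by lra.
have sm := simplex_convex s1 s2 (ltW h0) (ltW h1).
have := hsc _ _ _ i1 i2 p12 h0 h1.
rewrite (fin_partE hp (hdom _ s1)) (fin_partE hp (hdom _ s2)).
rewrite (fin_partE hp (hdom _ sm)) -!EFinM -EFinD lte_fin.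
move: (m1 _ sm) (m2 _ sm) (m1 _ s2) (m2 _ s1).
rewrite /bregman ![dotv _ q]dotvC !dotvB !dotvD !dotvZ; lra.
Qed.

End MirrorDescentStep.

(** * Hoeffding's inequality *)

Section Hoeffding.
Context {R : realType}.

Lemma ge0_is_derive_ndecr (f f' : R -> R) (x : R) :
  (forall y : R, is_derive y 1 f (f' y)) -> (forall y, 0 < y -> 0 <= f' y) ->
  0 <= x -> f 0 <= f x.
Proof.
move=> df f'0 x0; have dv y : derivable f y 1 by case: (df y).
apply: (@ger0_derive1_ndecry _ f 0) => // [y|].
  rewrite in_itv/= andbT => y0; rewrite derive1E.
  by have /@derive_val -> := df y; exact: f'0.
by apply: derivable_within_continuous => y _.
Qed.

(* The second derivative in [y] of [y^2/8 + q y - ln (1 - q + q e^y)] is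
   [1/4 - u (1 - u)] with [u = q e^y / (1 - q + q e^y)]. *)
Lemma two_point_exp_le (q y : R) : 0 <= q -> q <= 1 -> 0 <= y ->
  1 - q + q * expR y <= expR (q * y + y ^+ 2 / 8).
Proof.
move=> q0 q1 y0.
pose D z : R := 1 - q + q * expR z.
have D0 z : 0 < D z.
  have e0 := expR_gt0 z; rewrite /D; have [->|qn0] := eqVneq q 0; first by lra.
  by rewrite ltr_wpDl ?subr_ge0// mulr_gt0// lt_def qn0.
have dD (z : R) : is_derive z 1 D (q * expR z).
  by rewrite /D; apply: is_derive_eq; rewrite /GRing.scale/=; ring.
pose g1 z : R := z / 4 + q - q * expR z / D z.
have g1_ge0 z : 0 <= z -> 0 <= g1 z.
  move=> z0; have -> : 0 = g1 0 by rewrite /g1 /D expR0 !mulr1 subrK divr1; lra.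
  have d1 (w : R) :
      is_derive w 1 g1 (1 / 4 - q * (1 - q) * expR w / (D w) ^+ 2).
    have Dw : D w != 0 by rewrite gt_eqF.
    rewrite /g1; apply: is_derive_eq; rewrite /GRing.scale/= /D; field.
    exact: Dw.
  apply: (ge0_is_derive_ndecr d1 _ z0) => w w0.
  have Dw := D0 w; rewrite subr_ge0 ler_pdivrMr ?exprn_gt0//.
  (* With this square, D^2 >= 4 q (1 - q) e^w, that is, u (1 - u) <= 1/4. *)
  have := sqr_ge0 (q * expR w - (1 - q)); rewrite /D; lra.
rewrite -/(D y) -[leLHS]lnK ?posrE// ler_expR -subr_ge0.
pose g z : R := q * z + z ^+ 2 / 8 - ln (D z).
have -> : 0 = g 0.
  by rewrite /g /D expR0 mulr0 expr0n mul0r addr0 mulr1 subrK ln1 subr0.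
have dg (z : R) : is_derive z 1 g (g1 z).
  have Dz := D0 z; have dl := is_derive1_ln Dz.
  rewrite /g; apply: is_derive_eq; rewrite /g1 /GRing.scale/=; field.
  by rewrite gt_eqF.
by apply: (ge0_is_derive_ndecr dg _ y0) => z /ltW; exact: g1_ge0.
Qed.

(** On [a, b] the exponential lies below its chord, so the mean is at most that of the law on the
    two points a and b with the same expectation. There [two_point_exp_le] applies, with q the mass
    at b. *)
Lemma hoeffding_mgf (Z : finType) (p f : Z -> R) (a b y : R) :
  (forall z, 0 <= p z) -> \sum_z p z = 1 -> (forall z, a <= f z <= b) ->
  0 <= y ->
  \sum_z p z * expR (y * (f z - \sum_z' p z' * f z')) <=
    expR (y ^+ 2 * (b - a) ^+ 2 / 8).
Proof.
move=> p0 p1 fab y0; set mu := \sum_z' p z' * f z'.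
have amu : a <= mu.
  rewrite -[a]mul1r -p1 big_distrl/=; apply: ler_sum => z _.
  by rewrite ler_wpM2l//; case/andP: (fab z).
have mub : mu <= b.
  rewrite -[b]mul1r -p1 big_distrl/=; apply: ler_sum => z _.
  by rewrite ler_wpM2l//; case/andP: (fab z).
(* If a = b the chord is undefined, but f is then constantly equal to its mean. *)
have [ab|ab] := eqVneq a b.
  rewrite ab subrr expr0n mulr0 mul0r expR0 -p1; apply: ler_sum => z _.
  rewrite ler_piMr// expR_le1; have := fab z; have := amu; have := mub.
  by rewrite ab => ? ? /andP[? ?]; nra.
have {}ab : 0 < b - a by rewrite subr_gt0 lt_neqAle ab (le_trans amu mub).
pose q := (mu - a) / (b - a).
(* The tangent bound e^u >= 1 + u, used from f z to both endpoints and weighted by b - f z and f z -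
   a, suffices since the linear terms cancel. *)
have chord z : expR (y * (f z - mu)) <=
    ((b - f z) * expR (y * (a - mu)) + (f z - a) * expR (y * (b - mu))) / (b - a).
  rewrite ler_pdivlMr//; case/andP: (fab z) => az zb.
  have -> : y * (a - mu) = y * (f z - mu) + y * (a - f z) by ring.
  have -> : y * (b - mu) = y * (f z - mu) + y * (b - f z) by ring.
  rewrite !expRD; have e0 := expR_gt0 (y * (f z - mu)).
  rewrite !(mulrCA _ (expR (y * (f z - mu)))) -mulrDr ler_pM2l//.
  have := expR_ge1Dx (y * (a - f z)); have := expR_ge1Dx (y * (b - f z)).
  move=> eb ea.
  have : (b - f z) * (1 + y * (a - f z)) <= (b - f z) * expR (y * (a - f z)).
    by rewrite ler_wpM2l// subr_ge0.
  have : (f z - a) * (1 + y * (b - f z)) <= (f z - a) * expR (y * (b - f z)).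
    by rewrite ler_wpM2l// subr_ge0.
  lra.
apply: (@le_trans _ _ (\sum_z p z *
    (((b - f z) * expR (y * (a - mu)) + (f z - a) * expR (y * (b - mu))) / (b - a)))).
  by apply: ler_sum => z _; rewrite ler_wpM2l.
have -> : \sum_z p z *
    (((b - f z) * expR (y * (a - mu)) + (f z - a) * expR (y * (b - mu))) / (b - a)) =
    ((b - mu) * expR (y * (a - mu)) + (mu - a) * expR (y * (b - mu))) / (b - a).
  have lin (c e : R) : \sum_z p z * (c + e * f z) = c + e * mu.
    under eq_bigr do rewrite mulrDr mulrCA.
    by rewrite big_split/= -big_distrl -big_distrr/= p1 mul1r.
  rewrite -[RHS](_ : (b * expR (y * (a - mu)) - a * expR (y * (b - mu))) / (b - a)
     + (expR (y * (b - mu)) - expR (y * (a - mu))) / (b - a) * mu = _).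
    by rewrite -lin; apply: eq_bigr => z _; congr (_ * _); field; rewrite gt_eqF.
  by field; rewrite gt_eqF.
have q0 : 0 <= q by apply: divr_ge0; lra.
have q1 : q <= 1 by rewrite ler_pdivrMr// mul1r lerB.
have yb0 : 0 <= y * (b - a) by rewrite mulr_ge0// ltW.
have := two_point_exp_le q0 q1 yb0.
have -> : y * (a - mu) = - (q * (y * (b - a))) by rewrite /q; field; rewrite gt_eqF.
have -> : y * (b - mu) = y * (b - a) - (q * (y * (b - a))).
  by rewrite /q; field; rewrite gt_eqF.
set t := q * (y * (b - a)).
rewrite [in leRHS]expRD expRN (expRD (y * (b - a))) expRN => le.
have -> : ((b - mu) / expR t + (mu - a) * (expR (y * (b - a)) / expR t)) / (b - a) =
   (1 - q + q * expR (y * (b - a))) / expR t.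
  by rewrite /q; field; rewrite !gt_eqF// expR_gt0.
rewrite ler_pdivrMr ?expR_gt0// (le_trans le)// mulrC.
by rewrite exprMn.
Qed.

(** Chernoff's method: the indicator of the event is at most an exponential, whose mean factorizes
    over the coordinates, those outside J contributing 1. The value of y minimizes the resulting
    exponent. The subset J singles out the samples of one state or state-action pair among all those
    drawn. *)
Lemma hoeffding_upper (I Z : finType) (J : {set I}) (p : I -> Z -> R)
    (f : Z -> R) (mu a b t : R) :
  (forall i z, 0 <= p i z) -> (forall i, \sum_z p i z = 1) ->
  (forall z, a <= f z <= b) -> a < b -> 0 <= t ->
  (forall i, i \in J -> \sum_z p i z * f z = mu) ->
  \sum_(x : {ffun I -> Z} | #|J|%:R * t <= \sum_(i in J) (f (x i) - mu))
     \prod_i p i (x i) <=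
  expR (- (2 * #|J|%:R * t ^+ 2 / (b - a) ^+ 2)).
Proof.
move=> p0 p1 fab ab t0 pmu; pose y := 4 * t / (b - a) ^+ 2.
have ba0 : 0 < b - a by rewrite subr_gt0.
have y0 : 0 <= y by rewrite divr_ge0 ?sqr_ge0// mulr_ge0.
pose g i z : R := if i \in J then y * (f z - mu) else 0.
apply: (@le_trans _ _ (\sum_(x : {ffun I -> Z})
    expR (- (y * (#|J|%:R * t))) * \prod_i (p i (x i) * expR (g i (x i))))).
  rewrite big_mkcond/=; apply: ler_sum => x _.
  rewrite [X in _ <= _ * X]big_split/= [leRHS]mulrCA.
  have <- : expR (y * \sum_(i in J) (f (x i) - mu)) = \prod_i expR (g i (x i)).
    by rewrite big_distrr big_mkcond expR_sum.
  rewrite -expRD.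
  have pr0 : 0 <= \prod_i p i (x i) by apply: prodr_ge0.
  case: ifP => [le|_]; last by rewrite mulr_ge0// expR_ge0.
  by rewrite ler_peMr// -[leLHS]expR0 ler_expR addrC subr_ge0 ler_wpM2l.
rewrite -big_distrr/= -(bigA_distr_bigA (fun i z => p i z * expR (g i z)))/=.
have -> : - (2 * #|J|%:R * t ^+ 2 / (b - a) ^+ 2) =
    - (y * (#|J|%:R * t)) + \sum_(i in J) (y ^+ 2 * (b - a) ^+ 2 / 8).
  by rewrite sumr_const -mulr_natr /y; field; rewrite subr_eq0 gt_eqF.
rewrite expRD ler_pM2l ?expR_gt0// [X in expR X]big_mkcond expR_sum.
apply: ler_prod => i _; rewrite sumr_ge0/= => [|z _]; last first.
  by rewrite mulr_ge0// expR_ge0.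
rewrite /g; case: ifP => iJ.
  have := hoeffding_mgf (p0 i) (p1 i) fab y0.
  by rewrite (pmu _ iJ).
by rewrite expR0; under eq_bigr do rewrite mulr1; rewrite p1.
Qed.

Lemma hoeffding_two_sided (I Z : finType) (J : {set I}) (p : I -> Z -> R)
    (f : Z -> R) (mu a b t : R) :
  (forall i z, 0 <= p i z) -> (forall i, \sum_z p i z = 1) ->
  (forall z, a <= f z <= b) -> a < b -> 0 <= t ->
  (forall i, i \in J -> \sum_z p i z * f z = mu) -> (0 < #|J|)%N ->
  \sum_(x : {ffun I -> Z} | t < `|#|J|%:R^-1 * (\sum_(i in J) f (x i)) - mu|)
     \prod_i p i (x i) <=
  2 * expR (- (2 * #|J|%:R * t ^+ 2 / (b - a) ^+ 2)).
Proof.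
move=> p0 p1 fab ab t0 pmu J0.
have up := hoeffding_upper p0 p1 fab ab t0 pmu.
have fab' z : - b <= - f z <= - a by rewrite !lerN2 andbC.
have ab' : - b < - a by rewrite ltrN2.
have pmu' i : i \in J -> \sum_z p i z * - f z = - mu.
  by move=> /pmu <-; rewrite -sumrN; apply: eq_bigr => z _; rewrite mulrN.
have := hoeffding_upper p0 p1 fab' ab' t0 pmu'.
have -> : - a - - b = b - a by ring.
move=> lo; rewrite mulr2n mulrDl mul1r (le_trans _ (lerD up lo))//.
rewrite [X in _ <= X + _]big_mkcond [X in _ <= _ + X]big_mkcond -big_split/=.
rewrite big_mkcond/=; apply: ler_sum => x _.
have pr0 : 0 <= \prod_i p i (x i) by apply: prodr_ge0.
have Jn : 0 < #|J|%:R :> R by rewrite ltr0n.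
have -> : \sum_(i in J) (f (x i) - mu) = \sum_(i in J) f (x i) - #|J|%:R * mu.
  by rewrite sumrB sumr_const mulr_natl.
have -> : \sum_(i in J) (- f (x i) - - mu) = #|J|%:R * mu - \sum_(i in J) f (x i).
  by rewrite sumrB sumr_const sumrN mulNrn opprK mulr_natl addrC.
set s := \sum_(i in J) _.
have -> : #|J|%:R^-1 * s - mu = (s - #|J|%:R * mu) / #|J|%:R.
  by field; rewrite gt_eqF.
rewrite normf_div (gtr0_norm Jn) ltr_pdivlMr// [t * _]mulrC.
case: ifPn => [lt|_].
  have [s0|s0] := leP 0 (s - #|J|%:R * mu).
    by rewrite ger0_norm// in lt; rewrite (ltW lt) lerDl; case: ifP.
  rewrite ltr0_norm// opprB in lt; rewrite (ltW lt) lerDr; by case: ifP.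
by apply: addr_ge0; case: ifP.
Qed.

End Hoeffding.

(** * Policy evaluation *)

Lemma sum_pairE {R : realType} (T U : finType) (F : T * U -> R) :
  \sum_q F q = \sum_x \sum_y F (x, y).
Proof. by rewrite pair_bigA; apply: eq_bigr => -[]. Qed.

Lemma cvgn_sum {R : realType} (I : Type) (r : seq I) (u : I -> nat -> R)
    (l : I -> R) :
  (forall i, u i @ \oo --> l i) ->
  \sum_(i <- r) u i n @[n --> \oo] --> \sum_(i <- r) l i.
Proof.
move=> ul; elim: r => [|i r IH].
  by rewrite big_nil; under eq_fun do rewrite big_nil; exact: cvg_cst.
by rewrite big_cons; under eq_fun do rewrite big_cons; exact: cvgD.
Qed.

(** * Random variables with finitely many values *)

Section FinitelyValued.
Context {R : realType} {d : measure_display} {Om : measurableType d}.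
Context (Pr : probability Om R) {G : finType} (Z : Om -> G).
Hypothesis mZ : forall g, measurable (Z @^-1` [set g]).

Lemma finval_preimage (D : pred G) :
  [set w | D (Z w)] = \bigcup_(g in [set` D]) Z @^-1` [set g].
Proof.
apply/seteqP; split=> [w Dw|w [g /= Dg]]; first by exists (Z w).
by rewrite /preimage/= => ->.
Qed.

Lemma finval_measurable (D : pred G) : measurable [set w | D (Z w)].
Proof. by rewrite finval_preimage; apply: fin_bigcup_measurable. Qed.

Lemma finval_prob (D : pred G) :
  Pr [set w | D (Z w)] = (\sum_(g | D g) fine (Pr (Z @^-1` [set g])))%:E.
Proof.
rewrite finval_preimage measure_fin_bigcup//; last first.
  by move=> g g' _ _ [w [/= <- <-]].
rewrite -(@bigfs _ _ _ _ (index_enum G) D) ?index_enum_uniq// => [|g _]; last first.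
  by rewrite mem_index_enum.
rewrite -sumEFin.
by apply: eq_bigr => g _; rewrite fineK// fin_num_measure.
Qed.

Lemma finval_measurable_fun (f : G -> R) : measurable_fun setT (f \o Z).
Proof.
move=> _ Y _; rewrite setTI.
rewrite (_ : _ @^-1` _ = [set w | [pred g | `[< Y (f g) >]] (Z w)]).
  exact: finval_measurable.
by apply/seteqP; split=> w /= /asboolP.
Qed.

Lemma finval_integral (f : G -> R) : (forall g, 0 <= f g) ->
  (\int[Pr]_w (f (Z w))%:E = (\sum_g f g * fine (Pr (Z @^-1` [set g])))%:E)%E.
Proof.
move=> f0.
have fE w : (f (Z w))%:E = (\sum_g (f g)%:E * (\1_(Z @^-1` [set g]) w)%:E)%E.
  rewrite (bigD1 (Z w))//= big1 ?adde0 => [|g gZ].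
    by rewrite indicE mem_set//= mule1.
  rewrite indicE memNset ?mule0//= => gE; by rewrite gE eqxx in gZ.
under eq_integral do rewrite fE.
have mi g : measurable_fun setT (EFin \o (\1_(Z @^-1` [set g]) : Om -> R)).
  by apply/measurable_EFinP; exact: measurable_indic.
rewrite ge0_integral_sum//; first last.
- by move=> g w _; rewrite mule_ge0// lee_fin.
- by move=> g; apply: measurable_funeM; exact: mi.
rewrite -sumEFin; apply: eq_bigr => g _; rewrite ge0_integralZl_EFin//.
  by rewrite integral_indic// setIT EFinM fineK// fin_num_measure.
exact: mi.
Qed.

End FinitelyValued.

(** * Bellman operators of policies *)

Section Bellman.
Context {R : realType} {S A : finType} (M : mdp R S A).
Implicit Types (p : S -> 'rV[R]_#|A|) (v : S -> R) (g : S * A -> R).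
Local Notation gamma := (discount M).

Definition action_mean p g (s : S) : R := \sum_a entry p s a * g (s, a).

Definition state_mean v (z : S * A) : R := \sum_s' trans M z.1 z.2 s' * v s'.

Definition action_value v (z : S * A) : R :=
  reward M z.1 z.2 + gamma * state_mean v z.

Definition bellman p v : S -> R := action_mean p (action_value v).

Lemma entry_ge0 p s a : is_policy p -> 0 <= entry p s a.
Proof. by move=> /(_ s)[+ _]; apply. Qed.

Lemma sum_actions (f : 'I_#|A| -> R) : \sum_(i < #|A|) f i = \sum_a f (enum_rank a).
Proof. by rewrite (reindex enum_rank)//; apply: onW_bij; exact: enum_rank_bij. Qed.

Lemma entry_sum1 p s : is_policy p -> \sum_a entry p s a = 1.
Proof. by move=> /(_ s)[_ <-]; rewrite sum_actions. Qed.

Lemma action_mean_le p g g' s : is_policy p ->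
  (forall a, g (s, a) <= g' (s, a)) -> action_mean p g s <= action_mean p g' s.
Proof.
by move=> pp gg; apply: ler_sum => a _; rewrite ler_wpM2l// entry_ge0.
Qed.

Lemma action_mean_cst p (x : R) s : is_policy p ->
  action_mean p (fun=> x) s = x.
Proof. by move=> pp; rewrite /action_mean -big_distrl/= entry_sum1// mul1r. Qed.

Lemma action_meanD p g g' s :
  action_mean p (fun z => g z + g' z) s = action_mean p g s + action_mean p g' s.
Proof.
by rewrite /action_mean -big_split/=; apply: eq_bigr => a _; rewrite mulrDr.
Qed.

Lemma action_meanZ p g (x : R) s :
  action_mean p (fun z => x * g z) s = x * action_mean p g s.
Proof.
by rewrite /action_mean big_distrr/=; apply: eq_bigr => a _; rewrite mulrCA.
Qed.

Lemma state_mean_le v v' z : (forall s, v s <= v' s) ->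
  state_mean v z <= state_mean v' z.
Proof.
by move=> vv; apply: ler_sum => s _; rewrite ler_wpM2l// trans_ge0.
Qed.

Lemma state_mean_cst (x : R) z : state_mean (fun=> x) z = x.
Proof. by rewrite /state_mean -big_distrl/= trans_sum1 mul1r. Qed.

Lemma state_meanD v v' z :
  state_mean (fun s => v s + v' s) z = state_mean v z + state_mean v' z.
Proof.
by rewrite /state_mean -big_split/=; apply: eq_bigr => a _; rewrite mulrDr.
Qed.

Lemma action_mean_sum (I : Type) (r : seq I) (c : I -> R) (g : I -> S * A -> R)
    p s :
  action_mean p (fun z => \sum_(i <- r) c i * g i z) s =
  \sum_(i <- r) c i * action_mean p (g i) s.
Proof.
rewrite /action_mean; under eq_bigr do rewrite big_distrr/=.
rewrite exchange_big/=; apply: eq_bigr => i _.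
by rewrite big_distrr/=; apply: eq_bigr => a _; rewrite mulrCA.
Qed.

Lemma state_mean_sum (I : Type) (r : seq I) (c : I -> R) (v : I -> S -> R) z :
  state_mean (fun s => \sum_(i <- r) c i * v i s) z =
  \sum_(i <- r) c i * state_mean (v i) z.
Proof.
rewrite /state_mean; under eq_bigr do rewrite big_distrr/=.
rewrite exchange_big/=; apply: eq_bigr => i _.
by rewrite big_distrr/=; apply: eq_bigr => a _; rewrite mulrCA.
Qed.

Lemma state_mean_bounds v (x y : R) z : (forall s, x <= v s <= y) ->
  x <= state_mean v z <= y.
Proof.
move=> vxy; rewrite -[x](state_mean_cst x z) -[y](state_mean_cst y z).
by rewrite !state_mean_le// => s; case/andP: (vxy s).
Qed.

Lemma action_value_bounds v (x y : R) z : (forall s, x <= v s <= y) ->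
  gamma * x <= action_value v z <= 1 + gamma * y.
Proof.
move=> /(state_mean_bounds z)/andP[xv vy]; have g0 := discount_gt0 M.
rewrite /action_value -[leLHS]add0r !lerD ?ler_pM2l//.
  exact: reward_le1.
exact: reward_ge0.
Qed.

Lemma bellman_bounds p v (x y : R) s : is_policy p ->
  (forall s, x <= v s <= y) -> gamma * x <= bellman p v s <= 1 + gamma * y.
Proof.
move=> pp vxy; rewrite -[gamma * x](action_mean_cst _ s pp).
rewrite -[1 + gamma * y](action_mean_cst _ s pp) !action_mean_le// => a.
  by case/andP: (action_value_bounds (s, a) vxy).
by case/andP: (action_value_bounds (s, a) vxy).
Qed.

Lemma action_value_le v v' (x : R) z : (forall s, v s <= v' s + x) ->
  action_value v z <= action_value v' z + gamma * x.
Proof.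
move=> vv; rewrite /action_value -addrA lerD2l -mulrDr.
rewrite ler_pM2l ?discount_gt0//.
rewrite (le_trans (state_mean_le z vv))// (state_meanD v' (fun=> x)).
by rewrite state_mean_cst.
Qed.

Lemma bellman_le p v v' (x : R) s : is_policy p -> (forall s, v s <= v' s + x) ->
  bellman p v s <= bellman p v' s + gamma * x.
Proof.
move=> pp vv; rewrite -[leRHS](_ : action_mean p
    (fun z => action_value v' z + gamma * x) s = _).
  by apply: action_mean_le => // a; exact: action_value_le.
by rewrite (action_meanD p _ (fun=> gamma * x)) action_mean_cst.
Qed.

End Bellman.

Section PolicyEvaluation.
Context {R : realType} {S A : finType} (M : mdp R S A) (E : trajectory_model M).
Context (p : S -> 'rV[R]_#|A|) (pp : is_policy p).
Implicit Types (s : S) (g : S * A -> R).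
Local Notation gamma := (discount M).

Definition traj_pair (t : nat) (w : traj_space E) : S * A :=
  (traj_state t w, traj_action t w).

Definition traj_path (n : nat) (w : traj_space E) : {ffun 'I_n.+1 -> S * A} :=
  [ffun t : 'I_n.+1 => traj_pair t w].

(** This is the transition operator of the Markov chain of state-action pairs under p. *)
Definition next_mean g (z : S * A) : R := state_mean M (action_mean p g) z.

Lemma traj_pair_measurable t z : measurable (traj_pair t @^-1` [set z]).
Proof.
have -> : traj_pair t @^-1` [set z] =
    (@traj_state _ _ _ _ E t @^-1` [set z.1]) `&`
    (@traj_action _ _ _ _ E t @^-1` [set z.2]).
  by case: z => x y; apply/seteqP; split=> w; [move=> [<- <-]|move=> [/= <- <-]].
by apply: measurableI; [exact: traj_state_measurable|exact: traj_action_measurable].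
Qed.

Lemma traj_path_measurable n z : measurable (traj_path n @^-1` [set z]).
Proof.
have -> : traj_path n @^-1` [set z] =
    \bigcap_(t in [set: 'I_n.+1]) (traj_pair t @^-1` [set z t]).
  apply/seteqP; split=> [w <- t _|w wz]; first by rewrite /preimage/= ffunE.
  by apply/ffunP => t; rewrite ffunE; exact: wz.
by apply: fin_bigcap_measurable => // t _; exact: traj_pair_measurable.
Qed.

Lemma next_mean_ge0 g : (forall z, 0 <= g z) -> forall z, 0 <= next_mean g z.
Proof.
move=> g0 z; apply: sumr_ge0 => s _; rewrite mulr_ge0 ?trans_ge0//.
by apply: sumr_ge0 => a _; rewrite mulr_ge0// entry_ge0.
Qed.

Lemma next_meanE g z : next_mean g z =
  \sum_(q : S * A) g q * (trans M z.1 z.2 q.1 * entry p q.1 q.2).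
Proof.
rewrite /next_mean /state_mean /action_mean.
rewrite sum_pairE/=.
apply: eq_bigr => s _; rewrite big_distrr/=; apply: eq_bigr => a _.
by rewrite mulrA mulrC.
Qed.

Lemma traj_mean_init s g : (forall z, 0 <= g z) ->
  (\int[traj_prob E p s]_w (g (traj_pair 0 w))%:E = (action_mean p g s)%:E)%E.
Proof.
move=> g0; rewrite (finval_integral _ (traj_pair_measurable 0))//; congr EFin.
have law z : fine (traj_prob E p s (traj_pair 0 @^-1` [set z])) =
    (z.1 == s)%:R * entry p z.1 z.2.
  have := traj_law E s pp 0 (fun=> z.1) (fun=> z.2).
  rewrite big_ord0 mulr1 => law0.
  rewrite -[RHS]/(fine ((z.1 == s)%:R * entry p z.1 z.2)%:E) -law0.
  congr (fine (traj_prob _ _ _ _)).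
  apply/seteqP; split=> w /=; first by move=> <- [].
  by move=> /(_ 0%N isT)[]; rewrite /traj_pair => -> ->; rewrite -surjective_pairing.
under eq_bigr do rewrite law.
rewrite sum_pairE/=.
rewrite (bigD1 s)//= [X in _ + X]big1 ?addr0 => [|x xs].
  by apply: eq_bigr => a _; rewrite eqxx mul1r mulrC.
by apply: big1 => a _; rewrite (negPf xs) mul0r mulr0.
Qed.

(** This is the Markov property: by [traj_law], the joint law of the path up to n and the next pair
    is the law of the path times a transition weight, which depends only on the last pair of the
    path. *)
Lemma traj_mean_step s n g : (forall z, 0 <= g z) ->
  (\int[traj_prob E p s]_w (g (traj_pair n.+1 w))%:E =
   \int[traj_prob E p s]_w (next_mean g (traj_pair n w))%:E)%E.
Proof.
move=> g0; pose Z (w : traj_space E) := (traj_path n w, traj_pair n.+1 w).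
have ZE z q : Z @^-1` [set (z, q)] =
    (traj_path n @^-1` [set z]) `&` (traj_pair n.+1 @^-1` [set q]).
  by apply/seteqP; split=> w; [move=> [<- <-]|rewrite /Z/preimage/= => -[<- <-]].
have mZ z : measurable (Z @^-1` [set z]).
  case: z => z q; rewrite ZE; apply: measurableI.
    exact: traj_path_measurable.
  exact: traj_pair_measurable.
have -> : (\int[traj_prob E p s]_w (g (traj_pair n.+1 w))%:E =
           \int[traj_prob E p s]_w ((g \o snd) (Z w))%:E)%E by [].
rewrite (finval_integral _ mZ) => [|z]; last exact: g0.
have -> : (\int[traj_prob E p s]_w (next_mean g (traj_pair n w))%:E =
    \int[traj_prob E p s]_w
      ((fun z => next_mean g (z ord_max)) (traj_path n w))%:E)%E.
  by apply: eq_integral => w _; rewrite /= ffunE.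
rewrite (@finval_integral _ _ _ _ _ _ (@traj_path_measurable n)
  (fun z => next_mean g (z ord_max))) => [|z]; last exact: next_mean_ge0.
congr EFin; pose P z q := fine (traj_prob E p s (Z @^-1` [set (z, q)])).
rewrite sum_pairE/=.
apply: eq_bigr => z _; rewrite next_meanE big_distrl/=; apply: eq_bigr => q _.
rewrite -mulrA; congr (_ * _); rewrite mulrC.
(* [traj_law] takes sequences indexed by all naturals, so the path z is continued by q. Only the
   times up to n.+1 are read. *)
pose x t := if (t <= n)%N then (z (inord t)).1 else q.1.
pose y t := if (t <= n)%N then (z (inord t)).2 else q.2.
have zE (t : 'I_n.+1) : z t = (x t, y t).
  by rewrite /x /y -ltnS ltn_ord inord_val; case: (z t).
have pathE w : traj_path n w = z <->
    forall t, (t <= n)%N -> traj_state t w = x t /\ traj_action t w = y t.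
  split=> [wz t tn|wxy].
    have := zE (Ordinal (tn : (t < n.+1)%N)).
    by rewrite -wz ffunE/= => -[-> ->].
  apply/ffunP => t; rewrite ffunE zE /traj_pair.
  by have [-> ->] := wxy t (ltn_ord t : (t <= n)%N).
have lawn := traj_law E s pp n x y; have lawS := traj_law E s pp n.+1 x y.
have -> : traj_path n @^-1` [set z] = [set w | forall t, (t <= n)%N ->
    traj_state t w = x t /\ traj_action t w = y t].
  by apply/seteqP; split=> w; exact: (pathE w).1 || exact: (pathE w).2.
rewrite lawn/= /P.
have -> : Z @^-1` [set (z, q)] = [set w | forall t, (t <= n.+1)%N ->
    traj_state t w = x t /\ traj_action t w = y t].
  have xn : (x n.+1, y n.+1) = q by rewrite /x /y ltnn; case: (q).
  rewrite ZE; apply/seteqP; split=> w.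
    move=> [/pathE wz wq] t; rewrite leq_eqVlt => /predU1P[->|]; last exact: wz.
    by move: wq; rewrite /preimage/= -xn => -[-> ->].
  move=> wxy; split; first by apply/pathE => t tn; apply: wxy; exact: leqW.
  by rewrite /preimage/= -xn /traj_pair; have [-> ->] := wxy n.+1 (leqnn _).
rewrite lawS/= big_ord_recr/= !mulrA; congr (_ * _); last first.
  by rewrite /x /y ltnn.
congr (_ * _); have := zE ord_max; rewrite /= => ->.
by rewrite /x /y leqnn ltnn.
Qed.

Lemma traj_mean s n g : (forall z, 0 <= g z) ->
  (\int[traj_prob E p s]_w (g (traj_pair n w))%:E =
   (action_mean p (iter n next_mean g) s)%:E)%E.
Proof.
elim: n g => [|n IH] g g0; first by rewrite traj_mean_init.
by rewrite traj_mean_step// IH ?iterSr//; exact: next_mean_ge0.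
Qed.

Definition partial_value (n : nat) s : R :=
  \sum_(0 <= t < n) gamma ^+ t *
    action_mean p (iter t next_mean (fun z => reward M z.1 z.2)) s.

(** The term t = 0 is the immediate reward; from each later term one factor gamma and one transition
    split off. *)
Lemma partial_valueS n s :
  partial_value n.+1 s = bellman M p (partial_value n) s.
Proof.
pose r (z : S * A) := reward M z.1 z.2.
rewrite /partial_value big_nat_recl//= expr0 mul1r -/r.
rewrite /bellman /action_value action_meanD action_meanZ; congr (_ + _).
have -> : state_mean M (partial_value n) =
    (fun z => \sum_(0 <= t < n) gamma ^+ t * next_mean (iter t next_mean r) z).
  by apply/funext => z; rewrite state_mean_sum.
rewrite action_mean_sum big_distrr/=.
by apply: eq_bigr => t _; rewrite exprS mulrA.
Qed.

Lemma partial_value_bounds n s : 0 <= partial_value n s <= (1 - gamma)^-1.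
Proof.
have g1 : 0 < 1 - gamma by rewrite subr_gt0 discount_lt1.
elim: n s => [|n IH] s; first by rewrite /partial_value big_geq// lexx invr_ge0 ltW.
rewrite partial_valueS; have /andP[] := bellman_bounds M s pp IH.
rewrite mulr0 => -> /le_trans; apply; rewrite le_eqVlt; apply/orP; left.
by apply/eqP; field; rewrite gt_eqF.
Qed.

Lemma traj_reward_partial_sum n s :
  (\int[traj_prob E p s]_w (\sum_(0 <= t < n) gamma ^+ t *
     reward M (traj_state t w) (traj_action t w))%:E =
   (partial_value n s)%:E)%E.
Proof.
pose r (z : S * A) := reward M z.1 z.2.
have r0 z : 0 <= r z by exact: reward_ge0.
have g0 t : 0 <= gamma ^+ t by rewrite exprn_ge0// ltW// discount_gt0.
have mr t : measurable_fun [set: traj_space E] (EFin \o (r \o traj_pair t)).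
  by apply/measurable_EFinP; apply: finval_measurable_fun; exact: traj_pair_measurable.
under eq_integral do rewrite -sumEFin.
rewrite ge0_integral_sum//; first last.
- by move=> t w _; rewrite lee_fin mulr_ge0// reward_ge0.
- by move=> t; under eq_fun do rewrite EFinM; apply: measurable_funeM; exact: mr.
rewrite -sumEFin; apply: eq_bigr => t _; under eq_integral do rewrite EFinM.
rewrite ge0_integralZl_EFin//; last exact: mr.
  by rewrite EFinM -traj_mean.
by move=> w _; rewrite lee_fin; exact: reward_ge0.
Qed.

(** Partial returns are dominated by the geometric series, so dominated convergence exchanges the
    limit and the expectation. *)
Lemma value_cvg s : partial_value n s @[n --> \oo] --> value E p s.
Proof.
have g0 := discount_gt0 M; have g1 := discount_lt1 M.
have gn : `|gamma| < 1 by rewrite gtr0_norm.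
pose u (w : traj_space E) (t : nat) :=
  gamma ^+ t * reward M (traj_state t w) (traj_action t w).
have u0 w t : 0 <= u w t by rewrite mulr_ge0 ?reward_ge0// exprn_ge0// ltW.
have ug w t : u w t <= geometric 1 gamma t.
  by rewrite /geometric/= mul1r ler_piMr ?reward_le1// exprn_ge0// ltW.
have geo0 t : 0 <= geometric 1 gamma t by exact: le_trans (u0 point t) (ug point t).
have cg := is_cvg_geometric_series (a := 1) gn.
have cu w : cvgn (series (u w)) by exact: series_le_cvg (u0 w) geo0 (ug w) cg.
have ub w n : series (u w) n <= (1 - gamma)^-1.
  have -> : (1 - gamma)^-1 = limn (series (geometric 1 gamma)).
    by rewrite (cvg_lim _ (cvg_geometric_series gn))// mul1r.
  apply: le_trans (ler_sum _ (fun t _ => ug w t)) _.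
  apply: (nondecreasing_cvgn_le _ cg).
  by apply: nondecreasing_series => t _ _; exact: geo0.
have [] := @dominated_convergence _ (traj_space E) R (traj_prob E p s) setT
  measurableT (fun n w => (series (u w) n)%:E)
  (fun w => (discounted_return w)%:E) (cst (1 - gamma)^-1%:E).
- move=> n; apply/measurable_EFinP; apply: measurable_sum => t.
  apply: measurable_funM => //.
  have -> : (fun w : traj_space E => reward M (traj_state t w) (traj_action t w)) =
    (fun z => reward M z.1 z.2) \o traj_pair t by [].
  by apply: finval_measurable_fun; exact: traj_pair_measurable.
- apply/measurable_EFinP; apply: (measurable_fun_cvg (h := fun n w => series (u w) n)).
    move=> n; apply: measurable_sum => t; apply: measurable_funM => //.
    have -> : (fun w : traj_space E => reward M (traj_state t w) (traj_action t w)) =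
      (fun z => reward M z.1 z.2) \o traj_pair t by [].
    by apply: finval_measurable_fun; exact: traj_pair_measurable.
  by move=> w _; exact: cu.
- apply: aeW => w _; apply: cvg_EFin; first by near=> n.
  exact: cu.
- exact: finite_measure_integrable_cst.
- apply: aeW => w n _ /=; rewrite lee_fin ger0_norm//.
  by apply: sumr_ge0 => t _; exact: u0.
(* The expectation of the return is finite, so [fine] in [value] loses nothing. *)
move=> /(integrable_fin_num measurableT) fin _.
under eq_fun do rewrite traj_reward_partial_sum.
by rewrite -(fineK fin) => /fine_cvg; rewrite /value unlock.
Unshelve. all: by end_near.
Qed.

Lemma value_bounds s : 0 <= value E p s <= (1 - gamma)^-1.
Proof.
apply/andP; split.
  have /cvgr_to_ge := value_cvg (s := s); apply; near=> n.
  by case/andP: (partial_value_bounds n s).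
have /cvgr_to_le := value_cvg (s := s); apply; near=> n.
by case/andP: (partial_value_bounds n s).
Unshelve. all: by end_near.
Qed.

(** Both sides are the limit of [partial_value] at n.+1, the right one because the Bellman operator
    is a finite sum and hence continuous. *)
Lemma value_bellman s : value E p s = bellman M p (value E p) s.
Proof.
have lhs : partial_value n.+1 s @[n --> \oo] --> value E p s.
  by rewrite (cvg_shiftS (partial_value ^~ s)); exact: value_cvg.
have rhs : partial_value n.+1 s @[n --> \oo] --> bellman M p (value E p) s.
  under eq_fun do rewrite partial_valueS.
  apply: cvgn_sum => a; apply: cvgM; first exact: cvg_cst.
  apply: cvgD; first exact: cvg_cst.
  apply: cvgM; first exact: cvg_cst.
  apply: cvgn_sum => s'; apply: cvgM; first exact: cvg_cst.
  exact: value_cvg.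
exact: cvg_unique lhs rhs.
Qed.

End PolicyEvaluation.

(** * Optimality and error propagation *)

Section FiniteMaximum.
Context {R : realType} {I : finType} (i0 : I).
Implicit Type f : I -> R.

Lemma le_fmax f i : f i <= fmax i0 f.
Proof. exact: le_bigmax. Qed.

Lemma fmax_le f (x : R) : (forall i, f i <= x) -> fmax i0 f <= x.
Proof. by move=> fx; exact: bigmax_le. Qed.

Lemma fmax_attained f : exists i, fmax i0 f = f i.
Proof.
rewrite /fmax; elim/big_ind: _ => [|x y [i ->] [j ->]|i _]; first by exists i0.
- by rewrite maxEle; case: ifP => _; [exists j|exists i].
- by exists i.
Qed.

Lemma norm_infty_le f (x : R) : 0 <= x -> (forall i, `|f i| <= x) ->
  norm_infty f <= x.
Proof. by move=> x0 fx; exact: bigmax_le. Qed.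

Lemma le_norm_infty f i : `|f i| <= norm_infty f.
Proof. exact: (le_bigmax _ (fun i => `|f i|)). Qed.

End FiniteMaximum.

Section Optimality.
Context {R : realType} {S A : finType} (a0 : A) (M : mdp R S A).
Context (E : trajectory_model M).
Implicit Types (p : S -> 'rV[R]_#|A|) (v : S -> R).
Local Notation gamma := (discount M).

Definition bellman_opt v (s : S) : R :=
  fmax a0 (fun a => action_value M v (s, a)).

Lemma action_mean_le_fmax p (g : S * A -> R) s : is_policy p ->
  action_mean p g s <= fmax a0 (fun a => g (s, a)).
Proof.
move=> pp; rewrite -(action_mean_cst (fmax a0 (fun a => g (s, a))) s pp).
by apply: action_mean_le => // a; exact: (le_fmax a0 (fun a => g (s, a))).
Qed.

Lemma bellman_opt_le v v' (x : R) s : (forall s, v s <= v' s + x) ->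
  bellman_opt v s <= bellman_opt v' s + gamma * x.
Proof.
move=> vv; apply: fmax_le => a; apply: (le_trans (action_value_le M (s, a) vv)).
by rewrite lerD2r; exact: (le_fmax a0 (fun a => action_value M v' (s, a))).
Qed.

(** The policy puts all its mass on a maximizing action. Used with the zero function, it also shows
    that policies exist, which the supremum in [opt_value] requires. *)
Lemma greedy_policy (g : S * A -> R) : exists2 p, is_policy p &
  forall s, action_mean p g s = fmax a0 (fun a => g (s, a)).
Proof.
have /choice[act actE] s := fmax_attained a0 (fun a => g (s, a)).
have ent s a : entry (fun s => delta_mx 0 (enum_rank (act s)) : 'rV[R]_#|A|) s a =
    (a == act s)%:R.
  by rewrite /entry mxE eqxx (inj_eq enum_rank_inj).
exists (fun s => delta_mx 0 (enum_rank (act s))) => [s|s].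
  split=> [i|]; first by rewrite mxE ler0n.
  rewrite sum_actions (bigD1 (act s))//= mxE !eqxx big1 ?addr0// => a /negPf aE.
  by rewrite mxE (inj_eq enum_rank_inj) aE andbF.
rewrite actE /action_mean (bigD1 (act s))//= ent eqxx mul1r big1 ?addr0// => a.
by move=> /negPf aE; rewrite ent aE mul0r.
Qed.

(** Taking for x the maximum m of f gives m <= gamma m + b. This replaces fixed-point arguments for
    the Bellman operators. *)
Lemma contraction_le (f : S -> R) (b : R) :
  (forall x, (forall s, f s <= x) -> forall s, f s <= gamma * x + b) ->
  forall s, f s <= b / (1 - gamma).
Proof.
move=> fc s; apply: (le_trans (le_fmax s f s)).
have [i iE] := fmax_attained s f.
have := fc _ (le_fmax s f) i; rewrite -iE => le.
by rewrite ler_pdivlMr ?subr_gt0 ?discount_lt1//; lra.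
Qed.

Lemma le_opt_value p s : is_policy p -> value E p s <= opt_value E s.
Proof.
move=> pp; apply: ub_le_sup; last by exists p.
exists (1 - gamma)^-1 => _ [q pq <-].
by case/andP: (value_bounds E pq s).
Qed.

Lemma opt_value_le s (x : R) : (forall p, is_policy p -> value E p s <= x) ->
  opt_value E s <= x.
Proof.
move=> px; apply: ge_sup; last by move=> _ [p pp <-]; exact: px.
have [p pp _] := greedy_policy (fun=> 0).
by exists (value E p s); exists p.
Qed.

Lemma opt_value_bounds s : 0 <= opt_value E s <= (1 - gamma)^-1.
Proof.
have [p pp _] := greedy_policy (fun=> 0).
apply/andP; split.
  by apply: le_trans (le_opt_value s pp); case/andP: (value_bounds E pp s).
by apply: opt_value_le => q qq; case/andP: (value_bounds E qq s).
Qed.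

(** One inequality holds policy by policy. For the other, [contraction_le] with b = 0 shows that a
    policy greedy for the optimal value attains it. *)
Lemma bellman_opt_value s : bellman_opt (opt_value E) s = opt_value E s.
Proof.
have le s' : opt_value E s' <= bellman_opt (opt_value E) s'.
  apply: opt_value_le => p pp; rewrite value_bellman//.
  apply: le_trans (action_mean_le_fmax _ _ pp).
  apply: action_mean_le => // a.
  have := @action_value_le _ _ _ M (value E p) (opt_value E) 0 (s', a).
  by rewrite mulr0 !addr0; apply => t; rewrite addr0; exact: le_opt_value.
apply/eqP; rewrite eq_le le andbT.
have [p pp pE] := greedy_policy (action_value M (opt_value E)).
have opt_le_p t : opt_value E t - value E p t <= 0 / (1 - gamma).
  apply: (@contraction_le (fun t => opt_value E t - value E p t)) => {t} x fx t.
  rewrite value_bellman// addr0 lerBlDr addrC (le_trans (le t))//.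
  rewrite [leLHS](_ : _ = bellman M p (opt_value E) t); last by rewrite /bellman pE.
  apply: bellman_le => // t'.
  by have := fx t'; rewrite lerBlDr addrC.
have {}opt_le_p t : opt_value E t <= value E p t + 0.
  by have := opt_le_p t; rewrite mul0r; lra.
rewrite -[leLHS]pE -/(bellman M p _ s).
have := bellman_le M s pp opt_le_p; rewrite mulr0 addr0 -value_bellman// => /le_trans.
by apply; exact: le_opt_value.
Qed.

End Optimality.

(** * Propagation of errors for a fixed outcome *)

Section ErrorPropagation.
Context {R : realType} {S A : finType} (a0 : A) (M : mdp R S A).
Context (E : trajectory_model M) (T : nat).
Context (V : nat -> S -> R) (pi : nat -> S -> 'rV[R]_#|A|) (b e err : nat -> R).
Local Notation gamma := (discount M).
Hypothesis pi_policy : forall k, (k < T)%N -> is_policy (pi k.+1).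
Hypothesis improvement : forall k s, (k < T)%N ->
  bellman_opt a0 M (V k) s - b k <= bellman M (pi k.+1) (V k) s.
Hypothesis evaluation : forall k s, (k < T)%N ->
  `|V k.+1 s - bellman M (pi k.+1) (V k) s| <= e k.
Hypothesis err0 : forall s, `|V 0 s - opt_value E s| <= err 0.
Hypothesis errS : forall k, err k.+1 = gamma * err k + b k + e k.
Hypothesis b_ge0 : forall k, 0 <= b k.

(** An iteration contracts the distance to the optimal value by gamma, then adds the defect b of the
    greedy step and the error e of the evaluation. The defect enters only the lower estimate, as no
    policy exceeds [bellman_opt]. *)
Lemma value_iterate_error k s : (k <= T)%N -> `|V k s - opt_value E s| <= err k.
Proof.
elim: k s => [//|k IH] s kT.
have VE t : V k t <= opt_value E t + err k.
  by have := IH t (ltnW kT); rewrite ler_norml => /andP[]; lra.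
have EV t : opt_value E t <= V k t + err k.
  by have := IH t (ltnW kT); rewrite ler_norml => /andP[]; lra.
have := bellman_opt_le a0 M s VE; have := bellman_opt_le a0 M s EV.
rewrite (bellman_opt_value a0) errS.
have : bellman M (pi k.+1) (V k) s <= bellman_opt a0 M (V k) s.
  by apply: action_mean_le_fmax; exact: pi_policy.
have := improvement s kT; have := evaluation s kT; have := b_ge0 k.
by rewrite !ler_norml => ? /andP[? ?] ? ? ? ?; lra.
Qed.

(** If x bounds the suboptimality of the new policy, passing from the optimal value to V k costs
    gamma err, the greedy defect costs b, and passing from V k to the value of the policy costs
    gamma (err + x). Then [contraction_le] solves for x. *)
Lemma greedy_policy_error k s : (k < T)%N ->
  opt_value E s - value E (pi k.+1) s <=
    (2 * gamma * err k + b k) / (1 - gamma).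
Proof.
move=> kT; have pp := pi_policy kT; move: s.
apply: contraction_le => x fx s.
have EV t : opt_value E t <= V k t + err k.
  by have := value_iterate_error t (ltnW kT); rewrite ler_norml => /andP[]; lra.
have Vp t : V k t <= value E (pi k.+1) t + (err k + x).
  have := value_iterate_error t (ltnW kT); have := fx t.
  by rewrite ler_norml => ? /andP[]; lra.
have := bellman_opt_le a0 M s EV; rewrite (bellman_opt_value a0).
have := bellman_le M s pp Vp; rewrite -value_bellman//.
by have := improvement s kT; lra.
Qed.

End ErrorPropagation.

(** * Numerical estimates for the final constant *)

Section Constants.
Context {R : realType}.

(** The tangent at 0 would give only e^2 >= 3. It is used at 1/8 instead, followed by four squarings
    with rounding down. *)
Lemma expR2_ge6 : 6 <= expR 2 :> R.
Proof.
pose x : R := expR (1 / 8).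
have x1 : 9 / 8 <= x by have := expR_ge1Dx (1 / 8 : R); rewrite /x; lra.
have x2 : 63 / 50 <= x ^+ 2 by rewrite expr2; nra.
have x4 : 79 / 50 <= x ^+ 4 by rewrite (exprM x 2 2) expr2; nra.
have x8 : 5 / 2 - 1 / 100 <= x ^+ 8 by rewrite (exprM x 4 2) expr2; nra.
have -> : expR (2 : R) = x ^+ 16 by rewrite /x -expRM_natl; congr expR; field.
by rewrite (exprM x 8 2) expr2; nra.
Qed.

(** The tangent of the exponential at 2 is e^2 (y - 1). *)
Lemma expR_ge_affine (y : R) : 6 * (y - 1) <= expR y.
Proof.
have [y1|y1] := leP y 1; first by apply: le_trans (expR_ge0 y); lra.
have -> : expR y = expR 2 * expR (y - 2) by rewrite -expRD; congr expR; lra.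
have := expR2_ge6; have := expR_ge1Dx (y - 2); have := expR_gt0 (y - 2).
nra.
Qed.

(* With m = n (1 - g) one has g^n <= e^(-m), and e^m >= 6 (m - 1) as e^2 >= 6. *)
Lemma error_constant_le7 (g : R) (n : nat) : 0 < g -> g < 1 ->
  2 * g * ((1 + 2 * g) * (1 - g ^+ n) + 3 * n%:R * g ^+ n * (1 - g)) +
    (1 - g) * (2 * g * (1 + g ^+ n)) <= 7.
Proof.
move=> g0 g1; set x := g ^+ n; pose m := n%:R * (1 - g).
have x0 : 0 < x by rewrite exprn_gt0.
have x1 : x <= 1 by rewrite exprn_ile1// ltW.
have xm : x * expR m <= 1.
  rewrite -ler_pdivlMr ?expR_gt0// mul1r -expRN /m -mulrN expRM_natl.
  have ge : g <= expR (- (1 - g)) by apply: le_trans (expR_ge1Dx _); lra.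
  by apply: lerXn2r; rewrite ?nnegrE ?expR_ge0// ltW.
have xm1 : 6 * (x * (m - 1)) <= 1.
  apply: le_trans xm; rewrite mulrCA ler_pM2l//.
  exact: expR_ge_affine.
have gxm : 6 * (g * (x * (m - 1))) <= 1 by nra.
have gx : g * x <= 1 by nra.
have gx1 : 6 * (g * x) * (1 - g) <= 6 * (1 - g) by nra.
(* The last two terms on the right are at most 1 and 6 (1 - g), which leaves 7 - 2 g (1 - g). *)
have -> : 2 * g * ((1 + 2 * g) * (1 - x) + 3 * n%:R * x * (1 - g)) +
    (1 - g) * (2 * g * (1 + x)) =
    7 - 1 - (1 - g) * (6 + 2 * g) + 6 * (g * (x * (m - 1))) + 6 * (g * x) * (1 - g).
  by rewrite /m; ring.
nra.
Qed.

(* Closed form of the recursion td_errorS started at 2 / (1 - g). *)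
Definition td_error (g c delta : R) (n : nat) : R :=
  (2 * g ^+ n + c * g ^+ n * (1 - g ^+ n) + (1 + 2 * g) * (1 - g ^+ n) * delta)
    / (1 - g) + 3 * n%:R * g ^+ n * delta.

Lemma td_errorS (g c delta : R) n : g < 1 ->
  td_error g c delta n.+1 = g * td_error g c delta n +
    (c * g ^+ (2 * n + 1) + 2 * (g * (1 + g ^+ n) * delta)) +
    (1 + g ^+ n.+1) * delta.
Proof.
move=> g1; rewrite /td_error addn1 mul2n -addnn !exprS exprD -natr1.
set x := g ^+ n; field.
by rewrite subr_eq0 gt_eqF.
Qed.

(** The left side is the bound of [greedy_policy_error]. Multiplied by (1 - g)^2 it splits into an
    initial part, at most 4 g^n, a part from the step sizes, at most 2 c g^n, and a sampling part,
    at most 7 delta. *)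
Lemma td_error_final (g c delta : R) n : 0 < g -> g < 1 -> 0 < c -> 0 < delta ->
  (2 * g * td_error g c delta n +
   (c * g ^+ (2 * n + 1) + 2 * (g * (1 + g ^+ n) * delta))) / (1 - g) <=
  ((1 - g) ^+ 2)^-1 * (2 * (2 + c) * g ^+ n + 7 * delta).
Proof.
move=> g0 g1 c0 d0; have g10 : 0 < 1 - g by rewrite subr_gt0.
have := error_constant_le7 n g0 g1.
rewrite /td_error addn1 mul2n -addnn exprS exprD.
have x0 : 0 < g ^+ n by rewrite exprn_gt0.
set x := g ^+ n in x0 *; set m : R := n%:R => le7.
rewrite [leRHS]mulrC ler_pdivlMr ?exprn_gt0//.
have -> : (2 * g * ((2 * x + c * x * (1 - x) + (1 + 2 * g) * (1 - x) * delta) /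
    (1 - g) + 3 * m * x * delta) + (c * (g * (x * x)) +
    2 * (g * (1 + x) * delta))) / (1 - g) * (1 - g) ^+ 2 =
    4 * (g * x) + c * (x * (g * (2 - x * (1 + g)))) +
    delta * (2 * g * ((1 + 2 * g) * (1 - x) + 3 * m * x * (1 - g)) +
    (1 - g) * (2 * g * (1 + x))).
  by field; rewrite gt_eqF.
have : delta * (2 * g * ((1 + 2 * g) * (1 - x) + 3 * m * x * (1 - g)) +
    (1 - g) * (2 * g * (1 + x))) <= delta * 7 by rewrite ler_pM2l.
have : g * x <= x by nra.
have : c * (x * (g * (2 - x * (1 + g)))) <= c * (x * 2).
  by rewrite !ler_pM2l//; nra.
nra.
Qed.

End Constants.

(** * Conditional probabilities and sample means *)

Section FiniteValuedEvents.
Context {R : realType} {d : measure_display} {Om : measurableType d}.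
Context (Pr : probability Om R).

Lemma finval_pair_measurable (F G : finType) (H : Om -> F) (X : Om -> G) :
  (forall f, measurable (H @^-1` [set f])) ->
  (forall x, measurable (X @^-1` [set x])) ->
  forall z, measurable ((fun w => (H w, X w)) @^-1` [set z]).
Proof.
move=> mH mX [f x].
have -> : (fun w => (H w, X w)) @^-1` [set (f, x)] =
    (H @^-1` [set f]) `&` (X @^-1` [set x]).
  by apply/seteqP; split=> w; rewrite /preimage/= => -[<- <-].
exact: measurableI.
Qed.

Lemma finval_ffun_measurable (I G : finType) (X : I -> Om -> G) :
  (forall i x, measurable (X i @^-1` [set x])) ->
  forall z, measurable ((fun w => [ffun i => X i w]) @^-1` [set z]).
Proof.
move=> mX z.
have -> : (fun w => [ffun i => X i w]) @^-1` [set z] =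
    \bigcap_(i in [set: I]) (X i @^-1` [set z i]).
  apply/seteqP; split=> [w <- i _|w wz]; first by rewrite /preimage/= ffunE.
  by apply/ffunP => i; rewrite ffunE; exact: wz.
exact: fin_bigcap_measurable.
Qed.

(** Given a value of H, the bad set is fixed and has conditional probability at most beta; summing
    over the finitely many values of H gives the bound. *)
Lemma conditional_prob_le (F G : finType) (H : Om -> F) (X : Om -> G)
    (wt : Om -> G -> R) (bad : Om -> pred G) (beta : R) :
  (forall f, measurable (H @^-1` [set f])) ->
  (forall x, measurable (X @^-1` [set x])) ->
  (forall w x, Pr (H @^-1` [set H w] `&` X @^-1` [set x]) =
     Pr (H @^-1` [set H w]) * (wt w x)%:E)%E ->
  (forall w w', H w' = H w -> bad w' =1 bad w) ->
  (forall w, \sum_(x | bad w x) wt w x <= beta) -> 0 <= beta ->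
  measurable [set w | bad w (X w)] /\ (Pr [set w | bad w (X w)] <= beta%:E)%E.
Proof.
move=> mH mX law badE wtb b0.
(* The bad set is given through outcomes, hence the existential; values that H does not attain
   contribute nothing. *)
pose D : pred (F * G) := fun z => `[< exists w, H w = z.1 /\ bad w z.2 >].
have DE w x : D (H w, x) = bad w x.
  apply/asboolP/idP => /= [[w' [/badE ->]//]|bwx]; by exists w.
have -> : [set w | bad w (X w)] = [set w | D ((fun w => (H w, X w)) w)].
  by apply/seteqP; split=> w /=; rewrite DE.
have mZ := finval_pair_measurable mH mX.
split; first exact: finval_measurable.
rewrite (finval_prob Pr mZ) lee_fin big_mkcond sum_pairE/=.
have H1 : \sum_f fine (Pr (H @^-1` [set f])) = 1.
  have := finval_prob Pr mH predT; rewrite [X in Pr X](_ : _ = setT).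
    by rewrite probability_setT => -[<-].
  by apply/seteqP; split.
rewrite -[beta]mul1r -H1 big_distrl/=; apply: ler_sum => f _.
have [[w wf]|nf] := pselect (exists w, H w = f).
  have fE x : (if D (f, x) then
      fine (Pr ((fun w => (H w, X w)) @^-1` [set (f, x)])) else 0) =
      fine (Pr (H @^-1` [set f])) * (if bad w x then wt w x else 0).
    rewrite -wf DE; case: ifP => _; last by rewrite mulr0.
    have -> : (fun w => (H w, X w)) @^-1` [set (H w, x)] =
        (H @^-1` [set H w]) `&` (X @^-1` [set x]).
      by apply/seteqP; split=> w'; rewrite /preimage/= => -[<- <-].
    by rewrite law fineM ?fin_num_measure.
  under eq_bigr do rewrite fE.
  rewrite -big_distrr/= -big_mkcond/= ler_wpM2l// fine_ge0//.
rewrite big1 => [|x _]; first by rewrite mulr_ge0// fine_ge0.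
by case: ifP => // /asboolP[w [/= wf _]]; case: nf; exists w.
Qed.

Lemma union_bound (I : finType) (B : I -> set Om) (beta : R) :
  (forall i, measurable (B i)) -> (forall i, (Pr (B i) <= beta%:E)%E) ->
  measurable (\bigcup_(i in [set: I]) B i) /\
  (Pr (\bigcup_(i in [set: I]) B i) <= (#|I|%:R * beta)%:E)%E.
Proof.
move=> mB PB; split; first exact: fin_bigcup_measurable.
have -> : \bigcup_(i in [set: I]) B i = \big[setU/set0]_(i <- enum I) B i.
  rewrite -bigcup_seq; apply/seteqP; split=> w [i _ Bi]; exists i => //.
  by rewrite /= mem_enum.
rewrite cardE; elim: (enum I) => [|i r IH].
  by rewrite big_nil measure0 mul0r.
rewrite big_cons (le_trans (measureU2 _ _ _))//.
  exact: bigsetU_measurable.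
by rewrite /= -natr1 mulrDl mul1r addrC EFinD leeD.
Qed.

End FiniteValuedEvents.

Section SampleMeans.
Context {R : realType}.

Lemma prod_pairE (T U : finType) (F : T * U -> R) :
  \prod_q F q = \prod_x \prod_y F (x, y).
Proof. by rewrite pair_bigA; apply: eq_bigr => -[]. Qed.

Lemma sample_mean_bounds (n : nat) (f : 'I_n -> R) (a b : R) : (0 < n)%N ->
  (forall i, a <= f i <= b) -> a <= n%:R^-1 * \sum_(i < n) f i <= b.
Proof.
move=> n0 fab; have nR : 0 < n%:R :> R by rewrite ltr0n.
rewrite mulrC ler_pdivlMr// ler_pdivrMr//.
have E (x : R) : x * n%:R = \sum_(i < n) x by rewrite sumr_const card_ord mulr_natr.
by rewrite !E !ler_sum// => i _; case/andP: (fab i).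
Qed.

(** The deviation is proportional to the length W of the range, so W cancels and one sample size
    serves all iterations. *)
Lemma hoeffding_sample_size (m : nat) (x W delta N alpha : R) :
  0 < W -> 0 < x -> 0 < delta -> 0 < N -> 0 < alpha ->
  (2 * x ^+ 2 * delta ^+ 2)^-1 * ln (N / alpha) <= m%:R ->
  2 * expR (- (2 * m%:R * (W * x * delta) ^+ 2 / W ^+ 2)) <= 2 * (alpha / N).
Proof.
move=> W0 x0 d0 N0 al0; have c0 : 0 < 2 * x ^+ 2 * delta ^+ 2.
  by rewrite !mulr_gt0// exprn_gt0.
rewrite mulrC ler_pdivrMr// => le; rewrite ler_pM2l//.
have -> : alpha / N = expR (- ln (N / alpha)).
  by rewrite expRN lnK ?posrE ?divr_gt0// invf_div.
rewrite ler_expR lerN2 (le_trans le)// le_eqVlt; apply/orP; left; apply/eqP.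
by field; rewrite gt_eqF.
Qed.

(** All samples of an iteration are drawn jointly, but the mean uses only the block J of those drawn
    at [x0]. *)
Lemma sample_mean_deviation (U Z : finType) (m : nat) (x0 : U)
    (p : U -> Z -> R) (f : Z -> R) (a b t : R) : (0 < m)%N ->
  (forall u z, 0 <= p u z) -> (forall u, \sum_z p u z = 1) ->
  (forall z, a <= f z <= b) -> a < b -> 0 <= t ->
  \sum_(x : {ffun U * 'I_m -> Z} |
      t < `|m%:R^-1 * (\sum_(i < m) f (x (x0, i))) - \sum_z p x0 z * f z|)
     \prod_u \prod_(i < m) p u (x (u, i)) <=
  2 * expR (- (2 * m%:R * t ^+ 2 / (b - a) ^+ 2)).
Proof.
move=> m0 p0 p1 fab ab t0; pose J := [set q : U * 'I_m | q.1 == x0]%SET.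
have JE (g : U * 'I_m -> R) : \sum_(q in J) g q = \sum_(i < m) g (x0, i).
  rewrite big_mkcond sum_pairE/= (bigD1 x0)//= [X in _ + X]big1 ?addr0.
    by apply: eq_bigr => i _; rewrite inE eqxx.
  by move=> u ux; apply: big1 => i _; rewrite inE/= (negPf ux).
have Jm : #|J|%:R = m%:R :> R.
  by rewrite -sumr_const JE sumr_const card_ord.
have := @hoeffding_two_sided _ _ _ J (fun q => p q.1) f
  (\sum_z p x0 z * f z) a b t (fun q => p0 q.1) (fun q => p1 q.1) fab ab t0.
rewrite -(ltr0n R) Jm ltr0n => /(_ _ m0) le; apply: le_trans (le _) => //.
  rewrite le_eqVlt; apply/orP; left; apply/eqP; apply: eq_big => [x|x _].
    by rewrite JE.
  by rewrite prod_pairE.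
by move=> q; rewrite inE => /eqP ->.
Qed.

End SampleMeans.

(** * Sample-based TD-PMD *)

Section Run.
Context {R : realType} {S A : finType} (s0 : S) (a0 : A) (M : mdp R S A).
Context (h : 'rV[R]_#|A| -> \bar R) (h_legendre : legendre h).
Context (h_dom : @simplex R #|A| `<=` edom h) (T MQ MV : nat).
Hypotheses (MQ_gt0 : (0 < MQ)%N) (MV_gt0 : (0 < MV)%N).
Context (V0 : S -> R) (pi0 : S -> 'rV[R]_#|A|).
Hypothesis V0_bound : norm_infty V0 <= (1 - discount M)^-1.
Hypothesis pi0_policy : is_policy pi0.
Hypothesis pi0_rint : forall s, rint (edom h) (pi0 s).
Context (d : measure_display) (Om : measurableType d) (Pr : probability Om R).
Context (XQ : nat -> S -> A -> 'I_MQ -> Om -> S).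
Context (XV : nat -> S -> 'I_MV -> Om -> A * S).
Context (V : nat -> Om -> S -> R) (pi : nat -> Om -> S -> 'rV[R]_#|A|).
Context (eta : nat -> Om -> R).
Hypothesis run : td_pmd_run M h T Pr XQ XV V pi eta V0 pi0.
Local Notation gamma := (discount M).
Local Notation past := (past XQ XV).
Local Notation pastQ := (pastQ XQ XV).
Local Notation Qhat := (Qhat M XQ V).

(** The mirror step preserves interiority, so h is differentiable at every iterate. *)
Lemma run_policy k w : (k <= T)%N ->
  is_policy (pi k w) /\ forall s, interior (edom h) (pi k w s).
Proof.
elim: k => [_|k IH kT].
  have pi0E : pi 0 w = pi0 by apply/funext => s; exact: run_pi0 run w s.
  rewrite pi0E; split=> // s; apply: rint_edom_interior (pi0_rint s).
  by case: h_legendre.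
have [pk ik] := IH (ltnW kT); have upd := run_pi run w ^~ kT.
split=> s; first by case: (upd s).
exact: pmd_update_interior h_legendre h_dom (pk s) (ik s) (upd s).
Qed.

Lemma Qhat_past k w w' : V k w' = V k w -> pastQ k w w' -> Qhat k w' = Qhat k w.
Proof.
move=> VE [_ xE]; apply/funext => s; apply/rowP => j; rewrite !mxE VE.
by congr (_ * _); apply: eq_bigr => i _; rewrite xE.
Qed.

(** [is_pmd_update] is a relation; it is the uniqueness of the maximizer that makes the policies
    functions of the samples. *)
Lemma iterates_past k w w' : (k <= T)%N -> past k w w' ->
  V k w' = V k w /\ pi k w' = pi k w.
Proof.
elim: k => [_ _|k IH kT pkS].
  split; apply/funext => s.
    by rewrite !(run_V0 run).
  by rewrite !(run_pi0 run).
have pk : past k w w' by move=> j jk; apply: pkS; exact: leqW.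
have pQ : pastQ k w w' by split=> //; have [] := pkS k (ltnSn k).
have [VE piE] := IH (ltnW kT) pk.
have QE := Qhat_past VE pQ.
split; apply/funext => s.
  rewrite !(run_V run)// /TD_update VE; congr (_ * _); apply: eq_bigr => i _.
  by have [_ ->] := pkS k (ltnSn k).
have [pw iw] := run_policy w (ltnW kT).
have u := run_pi run w s kT; have := run_pi run w' s kT.
rewrite QE piE (run_eta run kT pQ) => u'.
exact: pmd_update_unique h_legendre h_dom (pw s) (iw s) u' u.
Qed.

Lemma policy_pastQ k w w' : (k < T)%N -> pastQ k w w' ->
  pi k.+1 w' = pi k.+1 w.
Proof.
move=> kT pQ; have [VE piE] := iterates_past (ltnW kT) pQ.1.
apply/funext => s; have [pw iw] := run_policy w (ltnW kT).
have u := run_pi run w s kT; have := run_pi run w' s kT.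
rewrite (Qhat_past VE pQ) piE (run_eta run kT pQ) => u'.
exact: pmd_update_unique h_legendre h_dom (pw s) (iw s) u' u.
Qed.

(** Rewards are nonnegative, so the negative part inherited from [V0] shrinks by gamma at each
    iteration. The upper bound is the fixed point of x -> 1 + gamma x. *)
Lemma value_iterate_bounds k w s : (k <= T)%N ->
  - (gamma ^+ k / (1 - gamma)) <= V k w s <= (1 - gamma)^-1.
Proof.
have g0 := discount_gt0 M; have g1 := discount_lt1 M.
elim: k s => [s _|k IH s kT].
  have := le_trans (le_norm_infty V0 s) V0_bound.
  by rewrite (run_V0 run) expr0 div1r ler_norml.
rewrite (run_V run)//; apply: sample_mean_bounds => // i.
have /andP[lo hi] := IH (XV k s i w).2 (ltnW kT).
have r0 := reward_ge0 M s (XV k s i w).1.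
have r1 := reward_le1 M s (XV k s i w).1.
apply/andP; split.
  by rewrite exprS -mulrA -mulrN -[leLHS]add0r lerD// ler_pM2l.
rewrite [leRHS](_ : _ = 1 + gamma * (1 - gamma)^-1).
  by rewrite lerD// ler_pM2l.
by field; rewrite subr_eq0 gt_eqF.
Qed.

(** * Samples and histories as finitely valued variables *)

Definition Qsample (k : nat) (w : Om) : {ffun S * A * 'I_MQ -> S} :=
  [ffun q : S * A * 'I_MQ => XQ k q.1.1 q.1.2 q.2 w].

Definition Vsample (k : nat) (w : Om) : {ffun S * 'I_MV -> A * S} :=
  [ffun q : S * 'I_MV => XV k q.1 q.2 w].

(** Entries from k on are filled with constants, so that histories of all lengths share one finite
    type. *)
Definition history (k : nat) (w : Om) :
    {ffun 'I_T -> {ffun S * A * 'I_MQ -> S} * {ffun S * 'I_MV -> A * S}} :=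
  [ffun j : 'I_T => if (j < k)%N then (Qsample j w, Vsample j w)
                    else ([ffun=> s0], [ffun=> (a0, s0)])].

Lemma Qsample_measurable k x : (k < T)%N -> measurable (Qsample k @^-1` [set x]).
Proof.
move=> kT; apply: finval_ffun_measurable => q z.
by apply: (run_XQ_measurable run).
Qed.

Lemma Vsample_measurable k x : (k < T)%N -> measurable (Vsample k @^-1` [set x]).
Proof.
move=> kT; apply: finval_ffun_measurable => q z.
by apply: (run_XV_measurable run).
Qed.

Lemma history_measurable k x : measurable (history k @^-1` [set x]).
Proof.
apply: (@finval_ffun_measurable _ _ _ _ (fun (j : 'I_T) w =>
  if (j < k)%N then (Qsample j w, Vsample j w)
  else ([ffun=> s0], [ffun=> (a0, s0)]))) => j z.
case: (j < k)%N; last first.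
  have [zE|zE] := pselect (([ffun=> s0], [ffun=> (a0, s0)]) = z).
    by rewrite (_ : _ @^-1` _ = setT)//; apply/seteqP; split.
  by rewrite (_ : _ @^-1` _ = set0)//; apply/seteqP; split.
by apply: finval_pair_measurable => y;
  [exact: Qsample_measurable|exact: Vsample_measurable].
Qed.

Lemma QsampleE k w w' : Qsample k w' = Qsample k w <->
  forall s a i, XQ k s a i w' = XQ k s a i w.
Proof.
split=> [/ffunP E s a i|E]; first by have := E (s, a, i); rewrite !ffunE.
by apply/ffunP => q; rewrite !ffunE.
Qed.

Lemma VsampleE k w w' : Vsample k w' = Vsample k w <->
  forall s i, XV k s i w' = XV k s i w.
Proof.
split=> [/ffunP E s i|E]; first by have := E (s, i); rewrite !ffunE.
by apply/ffunP => q; rewrite !ffunE.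
Qed.

Lemma history_past k w w' : (k <= T)%N -> history k w' = history k w <-> past k w w'.
Proof.
move=> kT; split=> [/ffunP E j jk|E].
  have := E (Ordinal (leq_trans jk kT)); rewrite !ffunE /= jk => -[EQ EV].
  by split; [exact/QsampleE|exact/VsampleE].
apply/ffunP => j; rewrite !ffunE; case: ifP => // /E[EQ EV].
by congr (_, _); [exact/QsampleE|exact/VsampleE].
Qed.

(** * Probability of large sampling errors *)

Context (delta alpha : R) (delta_gt0 : 0 < delta) (alpha_gt0 : 0 < alpha).
Hypothesis T_gt0 : (0 < T)%N.
Hypothesis MQ_bound : (2 * (1 - gamma) ^+ 2 * delta ^+ 2)^-1 *
  ln (4 * T%:R * #|S|%:R * #|A|%:R / alpha) <= MQ%:R.
Hypothesis MV_bound : (2 * (1 - gamma) ^+ 2 * delta ^+ 2)^-1 *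
  ln (4 * T%:R * #|S|%:R / alpha) <= MV%:R.

(* Both thresholds are (1 - gamma) * delta times the length of the range of the
   samples, as bounded by value_iterate_bounds. *)
Definition Q_deviates (k : nat) (z : S * A) : set Om :=
  [set w | gamma * (1 + gamma ^+ k) * delta <
    `|entry (Qhat k w) z.1 z.2 - action_value M (V k w) z|].

Definition V_deviates (k : nat) (s : S) : set Om :=
  [set w | (1 + gamma ^+ k.+1) * delta <
    `|V k.+1 w s - bellman M (pi k.+1 w) (V k w) s|].

Let card_gt0 (I : finType) (i : I) : 0 < #|I|%:R :> R.
Proof. by rewrite ltr0n; apply/card_gt0P; exists i. Qed.

Lemma Q_deviates_prob k z : (k < T)%N -> measurable (Q_deviates k z) /\
  (Pr (Q_deviates k z) <=
     (2 * (alpha / (4 * T%:R * #|S|%:R * #|A|%:R)))%:E)%E.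
Proof.
move=> kT; have g0 := discount_gt0 M; have g1 := discount_lt1 M.
have N0 : 0 < 4 * T%:R * #|S|%:R * #|A|%:R :> R.
  by rewrite !mulr_gt0// ?ltr0n// -(ltr0n R) card_gt0.
pose f w z' := reward M z.1 z.2 + gamma * V k w z'.
pose p (u : S * A) z' := trans M u.1 u.2 z'.
have mean w : \sum_z' p z z' * f w z' = action_value M (V k w) z.
  rewrite /f /action_value /state_mean.
  under eq_bigr do rewrite mulrDr mulrCA.
  by rewrite big_split/= -big_distrl/= trans_sum1 mul1r -big_distrr.
pose bad w (x : {ffun S * A * 'I_MQ -> S}) :=
  gamma * (1 + gamma ^+ k) * delta <
    `|MQ%:R^-1 * (\sum_(i < MQ) f w (x (z, i))) - action_value M (V k w) z|.
have -> : Q_deviates k z = [set w | bad w (Qsample k w)].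
  have E w : entry (Qhat k w) z.1 z.2 =
      MQ%:R^-1 * (\sum_(i < MQ) f w (Qsample k w (z, i))).
    rewrite /entry mxE enum_rankK; congr (_ * _); apply: eq_bigr => i _.
    by rewrite /f ffunE.
  by apply/seteqP; split=> w; rewrite /Q_deviates /bad/= E.
apply: (@conditional_prob_le _ _ _ Pr _ _ (history k) (Qsample k)
  (fun=> fun x => \prod_u \prod_(i < MQ) p u (x (u, i)))).
- exact: history_measurable.
- by move=> x; exact: Qsample_measurable.
- move=> w x; have := run_lawQ run w (fun s a i => x (s, a, i)) kT.
  have -> : history k @^-1` [set history k w] = past k w.
    by apply/seteqP; split=> w' /(history_past _ _ (ltnW kT)).
  have -> : [set w' | forall s a i, XQ k s a i w' = x (s, a, i)] =
      Qsample k @^-1` [set x].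
    apply/seteqP; split=> w' /= E; first by apply/ffunP => -[[s a] i]; rewrite ffunE E.
    by move=> s a i; rewrite -E ffunE.
  by move=> ->; rewrite prod_pairE.
- move=> w w' /(history_past _ _ (ltnW kT))/(iterates_past (ltnW kT))[VE _] x.
  by rewrite /bad /f VE.
- move=> w; rewrite /bad; pose W := gamma * (1 + gamma ^+ k) / (1 - gamma).
  have W0 : 0 < W.
    by rewrite divr_gt0 ?subr_gt0// mulr_gt0// addr_gt0// exprn_gt0.
  have tE : gamma * (1 + gamma ^+ k) * delta = W * (1 - gamma) * delta.
    by rewrite /W divfK// subr_eq0 gt_eqF.
  (* The reward at z is known, so only the value of the next state varies. *)
  have WE : W = reward M z.1 z.2 + gamma * (1 - gamma)^-1 -
      (reward M z.1 z.2 + gamma * - (gamma ^+ k / (1 - gamma))).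
    by rewrite /W; field; rewrite subr_eq0 gt_eqF.
  apply: le_trans (hoeffding_sample_size W0 _ delta_gt0 N0 alpha_gt0 MQ_bound).
    rewrite -mean [X in _ <= _ * expR (- (_ / X ^+ 2))]WE tE.
    apply: sample_mean_deviation => //.
    + by move=> u z'; exact: trans_ge0.
    + by move=> u; exact: trans_sum1.
    + move=> z'; have /andP[lo hi] := value_iterate_bounds w z' (ltnW kT).
      by rewrite /f !lerD2l !ler_pM2l// lo hi.
    + by rewrite -subr_gt0 -WE.
    + by apply: ltW; apply: mulr_gt0 => //; apply: mulr_gt0; rewrite ?subr_gt0.
  by rewrite subr_gt0.
- by rewrite mulr_ge0// divr_ge0// ltW.
Qed.

Lemma V_deviates_prob k s : (k < T)%N -> measurable (V_deviates k s) /\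
  (Pr (V_deviates k s) <= (2 * (alpha / (4 * T%:R * #|S|%:R)))%:E)%E.
Proof.
move=> kT; have g0 := discount_gt0 M; have g1 := discount_lt1 M.
have N0 : 0 < 4 * T%:R * #|S|%:R :> R.
  by rewrite !mulr_gt0// ?ltr0n// -(ltr0n R) card_gt0.
have pol w : is_policy (pi k.+1 w) by case: (run_policy w kT).
pose f w (z : A * S) := reward M s z.1 + gamma * V k w z.2.
pose p w (u : S) (z : A * S) := entry (pi k.+1 w) u z.1 * trans M u z.1 z.2.
have mean w : \sum_z p w s z * f w z = bellman M (pi k.+1 w) (V k w) s.
  rewrite sum_pairE; apply: eq_bigr => a _; rewrite /p /f /=.
  under eq_bigr do rewrite -mulrA.
  rewrite -big_distrr/= /action_value /state_mean; congr (_ * _).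
  under eq_bigr do rewrite mulrDr mulrCA.
  by rewrite big_split/= -big_distrl/= trans_sum1 mul1r -big_distrr.
pose bad w (x : {ffun S * 'I_MV -> A * S}) :=
  (1 + gamma ^+ k.+1) * delta <
    `|MV%:R^-1 * (\sum_(i < MV) f w (x (s, i))) -
      bellman M (pi k.+1 w) (V k w) s|.
have -> : V_deviates k s = [set w | bad w (Vsample k w)].
  have E w : V k.+1 w s = MV%:R^-1 * (\sum_(i < MV) f w (Vsample k w (s, i))).
    rewrite (run_V run)//; congr (_ * _); apply: eq_bigr => i _.
    by rewrite /f ffunE.
  by apply/seteqP; split=> w; rewrite /V_deviates /bad/= E.
have HQ w w' : (history k w', Qsample k w') = (history k w, Qsample k w) <->
    pastQ k w w'.
  split=> [[/(history_past _ _ (ltnW kT)) ? /QsampleE ?]//|[? ?]].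
  by congr (_, _); [exact/(history_past _ _ (ltnW kT))|exact/QsampleE].
(* The conditioning includes the samples of step (i), which determine the policy that draws the
   actions of step (iii). *)
apply: (@conditional_prob_le _ _ _ Pr _ _
  (fun w => (history k w, Qsample k w)) (Vsample k)
  (fun w x => \prod_u \prod_(i < MV) p w u (x (u, i)))).
- apply: finval_pair_measurable; first exact: history_measurable.
  by move=> x; exact: Qsample_measurable.
- by move=> x; exact: Vsample_measurable.
- move=> w x; have := run_lawV run w (fun s i => x (s, i)) kT.
  have -> : (fun w => (history k w, Qsample k w)) @^-1`
      [set (history k w, Qsample k w)] = pastQ k w.
    by apply/seteqP; split=> w' /HQ.
  have -> : [set w' | forall s i, XV k s i w' = x (s, i)] = Vsample k @^-1` [set x].
    apply/seteqP; split=> w' /= E; first by apply/ffunP => -[u i]; rewrite ffunE E.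
    by move=> u i; rewrite -E ffunE.
  by move=> ->.
- move=> w w' /HQ pQ x; have [VE _] := iterates_past (ltnW kT) pQ.1.
  by rewrite /bad /f VE (policy_pastQ kT pQ).
- move=> w; rewrite /bad; pose W := (1 + gamma ^+ k.+1) / (1 - gamma).
  have W0 : 0 < W by rewrite divr_gt0 ?subr_gt0// addr_gt0// exprn_gt0.
  have tE : (1 + gamma ^+ k.+1) * delta = W * (1 - gamma) * delta.
    by rewrite /W divfK// subr_eq0 gt_eqF.
  (* The action is random here, so the reward also ranges over [0, 1]. *)
  have WE : W = 1 + gamma * (1 - gamma)^-1 -
      (0 + gamma * - (gamma ^+ k / (1 - gamma))).
    by rewrite /W exprS; field; rewrite subr_eq0 gt_eqF.
  apply: le_trans (hoeffding_sample_size W0 _ delta_gt0 N0 alpha_gt0 MV_bound).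
    rewrite -mean [X in _ <= _ * expR (- (_ / X ^+ 2))]WE tE.
    apply: sample_mean_deviation => //.
    + by move=> u z; rewrite mulr_ge0 ?trans_ge0// entry_ge0.
    + move=> u; rewrite sum_pairE -[RHS](entry_sum1 u (pol w)).
      by apply: eq_bigr => a _; rewrite /p/= -big_distrr/= trans_sum1 mulr1.
    + move=> z; have /andP[lo hi] := value_iterate_bounds w z.2 (ltnW kT).
      by rewrite /f !lerD ?reward_ge0 ?reward_le1 ?ler_pM2l.
    + by rewrite -subr_gt0 -WE.
    + by apply: ltW; apply: mulr_gt0 => //; apply: mulr_gt0; rewrite ?subr_gt0.
  by rewrite subr_gt0.
- by rewrite mulr_ge0// divr_ge0// ltW.
Qed.

(** Each of the two unions costs alpha / 2. *)
Lemma deviation_prob :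
  let B := \bigcup_(q in [set: 'I_T * (S * A)]) Q_deviates q.1 q.2 `|`
           \bigcup_(q in [set: 'I_T * S]) V_deviates q.1 q.2 in
  measurable B /\ (Pr B <= alpha%:E)%E.
Proof.
have devQ (q : 'I_T * (S * A)) := Q_deviates_prob q.2 (ltn_ord q.1).
have [mQ PQ] := union_bound (fun q => (devQ q).1) (fun q => (devQ q).2).
have devV (q : 'I_T * S) := V_deviates_prob q.2 (ltn_ord q.1).
have [mV PV] := union_bound (fun q => (devV q).1) (fun q => (devV q).2).
split; first exact: measurableU.
apply: le_trans (measureU2 _ mQ mV) _; apply: le_trans (leeD PQ PV) _.
rewrite -EFinD lee_fin !card_prod card_ord !natrM le_eqVlt; apply/orP; left.
have S0 := card_gt0 s0; have A0 := card_gt0 a0.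
have TR : 0 < T%:R :> R by rewrite ltr0n.
by apply/eqP; field; rewrite !gt_eqF.
Qed.

(** * Error bound outside the deviation events *)

Context (pihat : nat -> Om -> S -> 'rV[R]_#|A|).
Hypothesis pihat_policy : forall k w, (k < T)%N -> is_policy (pihat k w).
Hypothesis pihat_greedy : forall k w s, (k < T)%N ->
  dotv (pihat k w s) (Qhat k w s) = fmax a0 (entry (Qhat k w) s).
Context (c : R) (c_gt0 : 0 < c).
Hypothesis eta_bound : forall k w, (k < T)%N ->
  fmax s0 (policy_div h (pihat k w) (pi k w)) / (c * gamma ^+ (2 * k + 1)) <=
    eta k w.

(** In the comparison with [pihat] the divergence of the new policy is nonnegative and is dropped.
    That of [pihat], divided by the step size, is at most the stated defect. *)
Lemma pmd_near_greedy k w s : (k < T)%N ->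
  fmax a0 (entry (Qhat k w) s) - c * gamma ^+ (2 * k + 1) <=
    dotv (pi k.+1 w s) (Qhat k w s).
Proof.
move=> kT; have [pw iw] := run_policy w (ltnW kT).
have [sp pmax] := run_pi run w s kT.
have eta0 := run_eta_gt0 run w kT.
have cg0 : 0 < c * gamma ^+ (2 * k + 1).
  by rewrite mulr_gt0// exprn_gt0// discount_gt0.
have := pmax _ (pihat_policy w kT s).
have := bregman_ge0 h_legendre (iw s) (h_dom sp).
have := le_fmax s0 (policy_div h (pihat k w) (pi k w)) s.
have := eta_bound w kT; rewrite ler_pdivrMr// pihat_greedy// /policy_div.
move=> le1 le2 le3 le4; rewrite -(ler_pM2l eta0) mulrBr.
lra.
Qed.

(** The sampling error is paid twice, once to pass to [Qhat] in the maximum and once to return from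
    it under the new policy. *)
Lemma near_greedy_improvement k w s : (k < T)%N ->
  (forall z, ~ Q_deviates k z w) ->
  bellman_opt a0 M (V k w) s -
    (c * gamma ^+ (2 * k + 1) + 2 * (gamma * (1 + gamma ^+ k) * delta)) <=
  bellman M (pi k.+1 w) (V k w) s.
Proof.
move=> kT dev; have [pw _] := run_policy w kT.
set eps := gamma * (1 + gamma ^+ k) * delta.
have {}dev a : `|entry (Qhat k w) s a - action_value M (V k w) (s, a)| <= eps.
  by rewrite leNgt; apply/negP; exact: dev (s, a).
have opt : bellman_opt a0 M (V k w) s <= fmax a0 (entry (Qhat k w) s) + eps.
  apply: fmax_le => a; have := le_fmax a0 (entry (Qhat k w) s) a.
  by have := dev a; rewrite ler_norml => /andP[]; lra.
have : dotv (pi k.+1 w s) (Qhat k w s) <= bellman M (pi k.+1 w) (V k w) s + eps.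
  rewrite /dotv sum_actions /bellman -(action_mean_cst eps s pw) -action_meanD.
  apply: ler_sum => a _; rewrite ler_wpM2l ?entry_ge0//.
  by have := dev a; rewrite ler_norml -/(entry (Qhat k w) s a) => /andP[]; lra.
by have := pmd_near_greedy w s kT; lra.
Qed.

Context (E : trajectory_model M).
Let bound : R := ((1 - gamma) ^+ 2)^-1 *
  (2 * (2 + c) * gamma ^+ (T - 1) + 7 * delta).

(** The final policy, and with it the event, depends on the outcome only through the full history,
    which has finitely many values. *)
Lemma policy_error_measurable :
  measurable [set w |
    norm_infty (fun s => opt_value E s - value E (pi T w) s) <= bound].
Proof.
pose D : pred {ffun 'I_T -> {ffun S * A * 'I_MQ -> S} * {ffun S * 'I_MV -> A * S}} :=
  fun x => `[< exists2 w, history T w = x &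
    norm_infty (fun s => opt_value E s - value E (pi T w) s) <= bound >].
rewrite (_ : [set w | _] = [set w | D (history T w)]).
  by apply: finval_measurable => x; exact: history_measurable.
apply/seteqP; split=> w /=; first by move=> le; apply/asboolP; exists w.
move=> /asboolP[w' /(history_past _ _ (leqnn T))/(iterates_past (leqnn T))[_ ->]].
by [].
Qed.

Lemma policy_error_le w :
  (forall k z, (k < T)%N -> ~ Q_deviates k z w) ->
  (forall k s, (k < T)%N -> ~ V_deviates k s w) ->
  norm_infty (fun s => opt_value E s - value E (pi T w) s) <= bound.
Proof.
move=> Qdev Vdev; have g0 := discount_gt0 M; have g1 := discount_lt1 M.
have gX n : 0 < gamma ^+ n by rewrite exprn_gt0.
pose b k := c * gamma ^+ (2 * k + 1) + 2 * (gamma * (1 + gamma ^+ k) * delta).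
pose e k := (1 + gamma ^+ k.+1) * delta.
have b0 k : 0 <= b k.
  by rewrite addr_ge0// ltW// ?mulr_gt0// ?mulr_gt0// addr_gt0.
have pol k : (k < T)%N -> is_policy (pi k.+1 w).
  by move=> kT; case: (run_policy w kT).
have impr k s : (k < T)%N ->
    bellman_opt a0 M (V k w) s - b k <= bellman M (pi k.+1 w) (V k w) s.
  by move=> kT; apply: near_greedy_improvement => // z; exact: Qdev.
have eval k s : (k < T)%N ->
    `|V k.+1 w s - bellman M (pi k.+1 w) (V k w) s| <= e k.
  by move=> kT; rewrite leNgt; apply/negP; exact: Vdev.
(* At 0 the closed form is 2 / (1 - gamma), which bounds the distance because both values are at
   most 1 / (1 - gamma) in absolute value. *)
have err0 s : `|V 0 w s - opt_value E s| <= td_error gamma c delta 0.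
  have := value_iterate_bounds w s (leq0n T).
  have := opt_value_bounds a0 E s.
  rewrite /td_error expr0 subrr div1r !mulr0 !mul0r !addr0 mulr1 ler_norml.
  by move=> /andP[? ?] /andP[? ?]; apply/andP; split; lra.
have errS k : td_error gamma c delta k.+1 =
    gamma * td_error gamma c delta k + b k + e k by exact: td_errorS.
(* The last policy is computed from the value iterate of index T - 1, whence the exponent of
   gamma. *)
have T1 : (T - 1 < T)%N by rewrite subn1 prednK.
have TE : (T - 1).+1 = T by rewrite subn1 prednK.
have main s : opt_value E s - value E (pi T w) s <= bound.
  have := @greedy_policy_error _ _ _ a0 M E T (V ^~ w) (pi ^~ w) b e
    (td_error gamma c delta) pol impr eval err0 errS b0 (T - 1) s T1.
  rewrite TE => /le_trans; apply.
  exact: td_error_final.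
apply: norm_infty_le => [|s].
  rewrite mulr_ge0// ?invr_ge0 ?exprn_ge0 ?subr_ge0 ?ltW// addr_gt0//.
    by rewrite !mulr_gt0// addr_gt0.
  by rewrite mulr_gt0.
rewrite ger0_norm// subr_ge0; apply: le_opt_value.
by case: (run_policy w (leqnn T)).
Qed.

End Run.

Theorem theorem4p3 (R : realType) (S A : finType) (s0 : S) (a0 : A)
    (M : mdp R S A) (E : trajectory_model M)
    (h : 'rV[R]_#|A| -> \bar R)
    (h_legendre : legendre h)
    (h_dom : @simplex R #|A| `<=` edom h)
    (h_rint : (rint (edom h) `&` @simplex R #|A|) !=set0)
    (T MQ MV : nat) (T_gt0 : (0 < T)%N) (MQ_gt0 : (0 < MQ)%N)
    (MV_gt0 : (0 < MV)%N)
    (V0 : S -> R) (pi0 : S -> 'rV[R]_#|A|)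
    (V0_bound : norm_infty V0 <= (1 - discount M)^-1)
    (pi0_policy : is_policy pi0)
    (pi0_rint : forall s, rint (edom h) (pi0 s))
    (d : measure_display) (Om : measurableType d) (Pr : probability Om R)
    (XQ : nat -> S -> A -> 'I_MQ -> Om -> S)
    (XV : nat -> S -> 'I_MV -> Om -> A * S)
    (V : nat -> Om -> S -> R) (pi : nat -> Om -> S -> 'rV[R]_#|A|)
    (eta : nat -> Om -> R)
    (run : td_pmd_run M h T Pr XQ XV V pi eta V0 pi0)
    (pihat : nat -> Om -> S -> 'rV[R]_#|A|)
    (pihat_policy : forall k w, (k < T)%N -> is_policy (pihat k w))
    (pihat_greedy : forall k w s, (k < T)%N ->
       dotv (pihat k w s) (Qhat M XQ V k w s) =
       fmax a0 (entry (Qhat M XQ V k w) s))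
    (c : R) (c_gt0 : 0 < c)
    (eta_bound : forall k w, (k < T)%N ->
       fmax s0 (policy_div h (pihat k w) (pi k w)) /
         (c * discount M ^+ (2 * k + 1)) <= eta k w)
    (delta alpha : R) (delta_gt0 : 0 < delta)
    (alpha_gt0 : 0 < alpha) (alpha_lt1 : alpha < 1)
    (MQ_bound :
       (2 * (1 - discount M) ^+ 2 * delta ^+ 2)^-1 *
         ln (4 * T%:R * #|S|%:R * #|A|%:R / alpha) <= MQ%:R)
    (MV_bound :
       (2 * (1 - discount M) ^+ 2 * delta ^+ 2)^-1 *
         ln (4 * T%:R * #|S|%:R / alpha) <= MV%:R) :
  ((1 - alpha)%R%:E <=
   Pr [set w | (norm_infty (fun s => opt_value E s - value E (pi T w) s) <=
     ((1 - discount M) ^+ 2)^-1 *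
       (2 * (2 + c) * discount M ^+ (T - 1) + 7 * delta))%R])%E.
Proof.
have [mB PB] := deviation_prob s0 a0 h_legendre h_dom MQ_gt0 MV_gt0 V0_bound
  pi0_policy pi0_rint run delta_gt0 alpha_gt0 T_gt0 MQ_bound MV_bound.
set B := (X in measurable X) in mB PB.
have mE := policy_error_measurable s0 a0 h_legendre h_dom pi0_policy pi0_rint run
  delta c E.
apply: (@le_trans _ _ (Pr (~` B))).
  by rewrite probability_setC// EFinB; apply: leeB.
apply: le_measure; rewrite ?inE//; first exact: measurableC.
move=> w nB; apply: (policy_error_le h_legendre h_dom MV_gt0 V0_bound pi0_policy pi0_rint run
  delta_gt0 T_gt0 pihat_policy pihat_greedy c_gt0 eta_bound).
- by move=> k z kT Qd; apply: nB; left; exists (Ordinal kT, z).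
- by move=> k s kT Vd; apply: nB; right; exists (Ordinal kT, s).
Qed.
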